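(* Let $a,b$ be integers with $1\leq a\leq b$. Let $C\subset \mathbb{R}^2$ be the graph of a concave, continuous, piece-wise linear function $f:[0,b]\to\mathbb{R}_{\geq 0}$ with $f(0)=a\geq f(1)$ and $f(b)=0$, such that its segments have lattice points as end points. Let $\Delta$ be the convex hull of $C\cup\{(0,0)\}$. Then there exist a regular subdivision $\Delta_1,\ldots,\Delta_r$ of $\Delta$ and an upper-convex piece-wise linear function $v:\Delta\to\mathbb{R}$ realizing this subdivision and satisfying $v(\Delta\cap\mathbb{Z}^2)\subset\mathbb{Z}$, such that the gonality of the metric graph $\Gamma(v)$ is equal to $\mathrm{lw}(\Delta^{(1)})+2$ if $\Delta \not\cong 2\Upsilon$, and to $3$ if $\Delta \cong 2\Upsilon$.
   Context: Polygons. A lattice polygon is the convex hull in $\mathbb{R}^2$ of a finite (possibly empty) subset of $\mathbb{Z}^2$; lattice points are points of $\mathbb{Z}^2$. For a two-dimensional lattice polygon $\Delta$, $\Delta^{(1)}$ denotes the convex hull of the lattice points in the topological interior of $\Delta$ (possibly $\emptyset$). A $\mathbb{Z}$-affine transformation is a map $\mathbb{R}^2\to\mathbb{R}^2: x \mapsto Ax+b$ with $A \in \mathrm{GL}_2(\mathbb{Z})$, $b \in \mathbb{Z}^2$; $\Delta\cong\Delta'$ means $\varphi(\Delta)=\Delta'$ for some $\mathbb{Z}$-affine transformation $\varphi$. The lattice width $\mathrm{lw}(\Delta)$ of a non-empty lattice polygon is the smallest integer $s\ge 0$ such that some $\mathbb{Z}$-affine transformation $\varphi$ satisfies $\varphi(\Delta)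 \subset \{(x,y)\in\mathbb{R}^2 \mid 0\le y\le s\}$; by convention $\mathrm{lw}(\emptyset)=-1$. $2\Upsilon$ is twice (Minkowski multiple) $\Upsilon = \mathrm{Conv}\{(-1,-1),(1,0),(0,1)\}$. Subdivisions. A regular subdivision of a two-dimensional lattice polygon $\Delta$ is a collection $\Delta_1,\dots,\Delta_r$ of two-dimensional lattice polygons for which there is an upper-convex piece-wise linear function $v:\Delta\to\mathbb{R}$ such that $\Delta_1,\dots,\Delta_r$ are the maximal closed subsets of $\Delta$ on which $v$ is linear (i.e. affine); one says that $v$ realizes the subdivision. Here ''upper-convex'' means convex in the sense $v(sp+(1-s)q)\le s\,v(p)+(1-s)\,v(q)$ for $p,q\in\Delta$, $s\in[0,1]$. The metric graph $\Gamma(v)$. Assume $v(\Delta\cap\mathbb{Z}^2)\subset\mathbb{Z}$. Let $G(\Delta_1,\dots,\Delta_r)$ be the (multi)graph with vertex set $\{v_1,\dots,v_r\}$ in which, for all $\ell\ne m$, the number of edges between $v_\ell$ and $v_m$ is the integral length $L(\ell,m)$ of $\Delta_\ell\cap\Delta_m$, i.e. the number of lattice points of $\Delta_\ell\cap\Delta_m$ minus one if this intersection is non-empty, and $0$ otherwise. For each $\ell$, let $(a_{\ell 1},a_{\ell 2},1)$ be the primitive integral normal vector with third coordinate $1$ to the graph of $v|_{\Delta_\ell}$ in $\mathbb{R}^3$ (it exists because $v$ is integer-valued on lattice points). For $\ell\neq m$ with $L(\ell,m)>0$, let $d(\ell,m)$ be the greatest common divisor of the $2\times 2$ minors of $\begin{pmatrix}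 a_{\ell 1} & a_{\ell 2} & 1\\ a_{m1} & a_{m2} & 1\end{pmatrix}$. The graph $G(v)$ is obtained from $G(\Delta_1,\dots,\Delta_r)$ by replacing each edge between $v_\ell$ and $v_m$ by a linear graph (path) of length $d(\ell,m)$. $\Gamma(v)$ is the metric graph associated to $G(v)$: the compact connected metric space obtained by identifying each edge with the unit interval $[0,1]$ (a single point if $r=1$). Gonality of a metric graph $\Gamma$. A divisor $D=a_1p_1+\dots+a_sp_s$ on $\Gamma$ is an element of the free abelian group on the points of $\Gamma$; its degree is $a_1+\dots+a_s$, and it is effective if all coefficients are nonnegative. For a continuous $\phi:\Gamma\to\mathbb{R}$ whose restriction to each edge is piece-wise linear with integer slopes and finitely many pieces, $\mathrm{ord}_p(\phi)$ is the sum of the incoming slopes of $\phi$ at $p$, and $\mathrm{div}(\phi)=\sum_{p\in\Gamma}\mathrm{ord}_p(\phi)\cdot p$. Divisors $D,D'$ are equivalent if $D'-D=\mathrm{div}(\phi)$ for some such $\phi$; $|D|$ is the set of effective divisors equivalent to $D$. The rank $r(D)$ is $-1$ if and only if $|D|=\emptyset$, and $r(D)\ge r$ if and only if $|D-E|\ne\emptyset$ for all effective divisors $E$ of degree $r$. The gonality of $\Gamma$ is the minimal degree of a divisor on $\Gamma$ of rank one. *)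

(* Defs.v *)
From HB Require Import structures.
From mathcomp Require Import all_boot all_order all_algebra finmap.
From mathcomp Require Import all_classical all_reals all_analysis.
From mathcomp Require Import freeg.

Set Implicit Arguments.
Unset Strict Implicit.
Unset Printing Implicit Defensive.

Import Order.TTheory GRing.Theory Num.Theory.
Import numFieldNormedType.Exports.

Local Open Scope classical_set_scope.
Local Open Scope ring_scope.

Definition plane (R : realType) := (R^o * R^o)%type.

Section Polygons.
Variable R : realType.
Implicit Types (A P Q : set (plane R)) (v : plane R -> R^o).

Definition lattice : set (plane R) :=
  [set p | p.1 \is a Num.int /\ p.2 \is a Num.int].

Definition conv_hull A : set (plane R) :=
  \bigcap_(K in [set K : set (plane R) | convex_set K /\ A `<=` K]) K.

Definition lattice_polygon P : Prop :=
  exists S : set (plane R),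
    [/\ finite_set S, S `<=` lattice & P = conv_hull S].

(* The affine span of P is the whole plane. *)
Definition two_dimensional P : Prop :=
  forall k l m : R, (forall p, P p -> k * p.1 + l * p.2 = m) ->
    k = 0 /\ l = 0.

Definition interior_hull P : set (plane R) := conv_hull (interior P `&` lattice).

Definition Zaffine (phi : plane R -> plane R) : Prop :=
  exists (M : 'M[int]_2) (t : int * int), M \in unitmx /\
    forall p, phi p =
      ((M 0 0)%:~R * p.1 + (M 0 1)%:~R * p.2 + t.1%:~R,
       (M 1 0)%:~R * p.1 + (M 1 1)%:~R * p.2 + t.2%:~R).

Definition Zequivalent P Q : Prop :=
  exists phi, Zaffine phi /\ phi @` P = Q.

Definition fits_in_strip P (s : int) : Prop :=
  exists phi, Zaffine phi /\
    phi @` P `<=` [set p | 0 <= p.2 <= (s%:~R : R)].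

Definition is_lattice_width P (w : int) : Prop :=
  (P = set0 /\ w = -1) \/
  [/\ P !=set0, 0 <= w, fits_in_strip P w &
      forall s : int, 0 <= s -> fits_in_strip P s -> w <= s].

Definition Upsilon : set (plane R) :=
  conv_hull [set p | p \in [:: (-1, -1); (1, 0); (0, 1)]].

Definition twoUpsilon : set (plane R) := (fun p => 2 *: p) @` Upsilon.

Definition affine_on v A : Prop :=
  exists k l m : R, forall p, A p -> v p = k * p.1 + l * p.2 + m.

Definition piecewise_linear_on P v : Prop :=
  exists (n : nat) (A : 'I_n -> set (plane R)),
    (forall i, [/\ closed (A i), convex_set (A i) & affine_on v (A i)]) /\
    P = \bigcup_i A i.

(* Only convex sets compete for maximality: without this restriction the set
   where v agrees with an affine function that crosses its graph (in general a
   closed curve) would also be a maximal closed set of linearity. *)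
Definition linear_piece P v A : Prop :=
  [/\ A `<=` P, closed A, convex_set A & affine_on v A].

Definition linearity_domain P v A : Prop :=
  linear_piece P v A /\ forall B, linear_piece P v B -> A `<=` B -> A = B.

Definition realizes P v (r : nat) (D : 'I_r -> set (plane R)) : Prop :=
  [/\ convex_function P v, piecewise_linear_on P v
    & forall A, linearity_domain P v A <-> exists i, A = D i].

Definition regular_subdivision P (r : nat) (D : 'I_r -> set (plane R)) : Prop :=
  [/\ injective D,
      forall i, lattice_polygon (D i) /\ two_dimensional (D i)
    & exists v, realizes P v D].

End Polygons.

Section MetricGraphs.

(* The orientation of the edges only serves to parametrize them. *)
Structure multigraph := Multigraph {
  vertex : finType;
  edge : finType;
  source : edge -> vertex;
  target : edge -> vertex }.

Section Subdivision.
Variables (G : multigraph) (d : edge G -> nat).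

Definition subdivision_vertex : finType :=
  (vertex G + {e : edge G & 'I_(d e).-1})%type.

Definition subdivision_edge : finType := {e : edge G & 'I_(d e)}.

(* The k-th vertex of the path of length d e replacing e, for 0 <= k <= d e. *)
Definition path_vertex (e : edge G) (k : nat) : subdivision_vertex :=
  if k is k'.+1 then
    if (insub k' : option 'I_(d e).-1) is Some i then inr (existT _ e i)
    else inl (target e)
  else inl (source e).

Definition subdivision : multigraph := {|
  vertex := subdivision_vertex;
  edge := subdivision_edge;
  source := fun x : subdivision_edge => path_vertex (tag x) (tagged x);
  target := fun x : subdivision_edge => path_vertex (tag x) (tagged x).+1 |}.

End Subdivision.

Variables (R : realType) (G : multigraph).

(* The points of the metric graph of G, whose edges have length 1: vertices and
   interior points of edges. *)
Definition mpoint : choiceType :=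
  (vertex G + edge G * {t : R | 0 < t < 1})%type.

Definition edge_point (e : edge G) (t : R) : mpoint :=
  if insub t is Some u then inr (e, u)
  else if t <= 0 then inl (source e) else inl (target e).

Definition on_edge (phi : mpoint -> R) (e : edge G) : R -> R :=
  fun t => phi (edge_point e t).

(* The metric graph is a quotient of finitely many copies of `[0, 1] (and
   isolated vertices), so continuity is continuity along every edge. *)
Definition rational_function (phi : mpoint -> R) : Prop :=
  forall e, {within `[0, 1], continuous (on_edge phi e)} /\
    exists s : seq R, [/\ path <%R 0 s, last 0 s = 1 &
      forall I, I \in zip (0 :: s) s ->
        exists (k : int) (c : R),
          {in `[I.1, I.2], forall t, on_edge phi e t = k%:~R * t + c}].

Definition left_slope (g : R -> R) (t : R) : int :=
  xget 0 [set k : int | \forall s \near t^'-, g s = g t + k%:~R * (s - t)].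

Definition right_slope (g : R -> R) (t : R) : int :=
  xget 0 [set k : int | \forall s \near t^'+, g s = g t + k%:~R * (s - t)].

(* Sum of the incoming slopes: towards t, the slope is left_slope when coming
   from the left and - right_slope when coming from the right. *)
Definition ord (phi : mpoint -> R) (p : mpoint) : int :=
  match p with
  | inl x => \sum_(e | target e == x) left_slope (on_edge phi e) 1
             - \sum_(e | source e == x) right_slope (on_edge phi e) 0
  | inr (e, t) => left_slope (on_edge phi e) (val t)
                  - right_slope (on_edge phi e) (val t)
  end.

Definition divisor := {freeg mpoint / int}.
Implicit Types D E : divisor.

Definition effective D : Prop := forall p, 0 <= coeff p D.

Definition lin_equiv D D' : Prop :=
  exists2 phi, rational_function phi & forall p, coeff p (D' - D) = ord phi p.

Definition linear_system D : set divisor :=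
  [set D' | effective D' /\ lin_equiv D D'].

Definition rank_ge D (k : nat) : Prop :=
  forall E, effective E -> deg E = k%:Z -> linear_system (D - E) !=set0.

Definition has_rank D (k : int) : Prop :=
  (k = -1 /\ linear_system D = set0) \/
  exists n : nat, [/\ k = n%:Z, rank_ge D n & ~ rank_ge D n.+1].

Definition is_gonality (g : int) : Prop :=
  (exists2 D : divisor, has_rank D 1 & deg D = g) /\
  forall D, has_rank D 1 -> g <= deg D.

End MetricGraphs.

Section DualGraph.
Variables (R : realType) (r : nat) (D : 'I_r -> set (plane R)).

(* The value is 0, as desired, if the intersection contains no lattice point. *)
Definition int_length (l m : 'I_r) : nat :=
  #|` fset_set (D l `&` D m `&` @lattice R)|.-1.

(* int_length l m edges for every unordered pair of distinct l and m. *)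
Definition num_edges (lm : 'I_r * 'I_r) : nat :=
  if (lm.1 < lm.2)%N then int_length lm.1 lm.2 else 0%N.

Definition dual_edge : finType := {lm : 'I_r * 'I_r & 'I_(num_edges lm)}.

Definition dual_graph : multigraph := {|
  vertex := 'I_r;
  edge := dual_edge;
  source := fun e : dual_edge => (tag e).1;
  target := fun e : dual_edge => (tag e).2 |}.

Variable v : plane R -> R^o.

(* (n1, n2) such that (n1, n2, 1) is normal to the graph of v above A; it is
   unique if A is two-dimensional, and exists if A is moreover a lattice polygon
   on which v is affine and integral at lattice points. *)
Definition normal (A : set (plane R)) : int * int :=
  xget (0, 0) [set n : int * int |
    exists c : R, forall p, A p -> n.1%:~R * p.1 + n.2%:~R * p.2 + v p = c].

Definition minors_gcd (n n' : int * int) : nat :=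
  gcdn (absz (n.1 * n'.2 - n.2 * n'.1)%R)
    (gcdn (absz (n.1 * 1 - 1 * n'.1)%R) (absz (n.2 * 1 - 1 * n'.2)%R)).

(* Its metric graph is that of the points mpoint R weighted_graph. *)
Definition weighted_graph : multigraph :=
  @subdivision dual_graph
    (fun e => minors_gcd (normal (D (tag e).1)) (normal (D (tag e).2))).

End DualGraph.

Section Region.
Variables (R : realType) (b : int) (f : R^o -> R^o).

(* The segments of the graph of f over `[0, b] have lattice end points. *)
Definition lattice_piecewise_linear : Prop :=
  exists s : seq int, [/\ path <%R 0 s, last 0 s = b,
    forall x, x \in 0 :: s -> f x%:~R \is a Num.int &
    forall I, I \in zip (0 :: s) s ->
      exists k c : R, {in `[I.1%:~R, I.2%:~R], forall x : R, f x = k * x + c}].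

Definition region : set (plane R) :=
  conv_hull ([set p | 0 <= p.1 <= (b%:~R : R) /\ p.2 = f p.1] `|` [set (0, 0)]).

End Region.

(* Main.v *)
Require Import Defs.
From mathcomp Require Import all_boot all_order all_algebra finmap.
From mathcomp Require Import all_classical all_reals all_analysis.
From mathcomp Require Import freeg ring lra zify.

Set Implicit Arguments.
Unset Strict Implicit.
Unset Printing Implicit Defensive.

Import Order.TTheory GRing.Theory Num.Theory.
Import numFieldNormedType.Exports.
Local Open Scope classical_set_scope.
Local Open Scope ring_scope.

(** Concavity and [a <= b] put the triangle T with corners (0, 0), (a, 0),
    (0, a) inside Delta.  Put N = a - 1 if Delta = T, and N = a otherwise, and
    cut Delta along the lines x + y = 1, ..., x + y = N.  Each cut runs from
    (0, i) to (i, 0), so the N + 1 slices are lattice polygons, and what lies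
    beyond the last cut is convex even if its outer boundary is complicated.
    The slices are the domains of linearity of the maximum of the functions
    i (x + y) - i (i + 1) / 2 ([realizes_slices]).  Slopes of neighbouring
    slices differ by 1, so no edge of the dual graph gets subdivided, and the
    metric graph is a staircase: vertices 0, ..., N in a row, with i + 1 unit
    edges from i to i + 1 ([staircase_chain]).

    The gonality of the staircase is max (1, N) ([staircase_gonality]).  For
    the upper bound, put N chips on vertex N and sweep them down towards
    vertex 0: firing everything beyond a given level moves i + 1 chips along
    the edges between i and i + 1 and leaves a chip behind at each vertex
    already passed.

    For the lower bound, suppose that D has rank at least 1 and degree less
    than N, and for each vertex i choose an effective divisor D_i equivalent to
    D with a chip at i.  Let phi be the rational function that carries D_i to
    D_j.  If phi differed at the ends of the last N parallel edges, each of
    these edges would need a chip in its interior or a slope of at least 1,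
    hence a chip at its end ([moves_rise]); that takes N chips.  So no phi
    tells vertex N from vertex N - 1.  Then vertex N can be removed: let the
    chips inside the last edges join vertex N - 1 and drop those at vertex N.
    This keeps the divisors effective and equivalent on the smaller staircase
    and, starting from a divisor with a chip at N, lowers the degree.  So the
    bound degree < number of the last vertex persists down to vertex 0, where
    it says that an effective divisor has negative degree
    ([staircase_bound]).

    The lattice points inside Delta have 1 <= y <= N - 1, and for N >= 2 they
    include (1, 1), (1, N - 1) and (N - 1, 1); so the lattice width of their
    hull is N - 2 ([width_interior_triangle]), and it is -1 for N <= 1: in
    both cases max (1, N) - 2.

    The triangle 2 Upsilon never occurs.  Delta has the two coordinate
    functions as inner normals of edges, and they have determinant 1, while
    the primitive normals of any two edges of 2 Upsilon have determinant
    divisible by 3 ([quadrant_not_twoUpsilon]). *)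

(** * Piecewise linear functions on the unit interval *)

Lemma path_le_last (T : realDomainType) (a0 : T) s c :
  path <%R a0 s -> c \in a0 :: s -> c <= last a0 s.
Proof.
elim: s a0 c => [|a1 s IH] a0 c /=; first by rewrite inE => _ /eqP->.
move=> /andP[a01 ps]; rewrite inE => /orP[/eqP->|/(IH _ _ ps) //].
by apply: (le_trans (ltW a01)); apply: IH => //; rewrite mem_head.
Qed.

Section PiecewiseLinear.
Variable R : realType.
Implicit Types (g h : R -> R) (s B : seq R) (t a b c : R) (k : int).

Lemma right_slopeE g t k :
  (\forall s \near t^'+, g s = g t + k%:~R * (s - t)) -> right_slope g t = k.
Proof.
move=> gk; apply: xget_unique => //= k' gk'; apply/esym.
have H :
    \forall s \near t^'+, (g s = g t + k%:~R * (s - t) /\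
      g s = g t + k'%:~R * (s - t)) /\ t < s.
  near=> s; split; last by near: s; exact: nbhs_right_gt.
  by split; near: s.
have [s [[-> /addrI/eqP ks] st]] := @filter_ex _ _ (at_right_proper_filter t) _ H.
move: ks; rewrite -subr_eq0 -mulrBl mulf_eq0 !subr_eq0.
case/orP => [/eqP/intr_inj //|/eqP es].
by rewrite es ltxx in st.
Unshelve. all: by end_near. Qed.

Lemma left_slopeE g t k :
  (\forall s \near t^'-, g s = g t + k%:~R * (s - t)) -> left_slope g t = k.
Proof.
move=> gk; apply: xget_unique => //= k' gk'; apply/esym.
have H :
    \forall s \near t^'-, (g s = g t + k%:~R * (s - t) /\
      g s = g t + k'%:~R * (s - t)) /\ s < t.
  near=> s; split; last by near: s; exact: nbhs_left_lt.
  by split; near: s.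
have [s [[-> /addrI/eqP ks] st]] := @filter_ex _ _ (at_left_proper_filter t) _ H.
move: ks; rewrite -subr_eq0 -mulrBl mulf_eq0 !subr_eq0.
case/orP => [/eqP/intr_inj //|/eqP es].
by rewrite es ltxx in st.
Unshelve. all: by end_near. Qed.

Definition slope_on g k a b : Prop :=
  {in `[a, b], forall t, g t = g a + k%:~R * (t - a)}.

Lemma slope_on_right g k a b : a < b -> slope_on g k a b -> right_slope g a = k.
Proof.
move=> ab gk; apply: right_slopeE; near=> s; apply: gk.
by rewrite in_itv /=; apply/andP; split;
  near: s; [exact: nbhs_right_ge|exact: nbhs_right_le].
Unshelve. all: by end_near. Qed.

Lemma slope_on_left g k a b : a < b -> slope_on g k a b -> left_slope g b = k.
Proof.
move=> ab gk; apply: left_slopeE; near=> s.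
have gb : g b = g a + k%:~R * (b - a) by apply: gk; rewrite in_itv /= lexx ltW.
rewrite gb gk; first by ring.
by rewrite in_itv /=; apply/andP; split;
  near: s; [exact: nbhs_left_ge|exact: nbhs_left_le].
Unshelve. all: by end_near. Qed.

Lemma slope_onB g h k l a b :
  slope_on g k a b -> slope_on h l a b -> slope_on (g \- h) (k - l) a b.
Proof. by move=> gk hl t tab; rewrite /= gk// hl// intrB; ring. Qed.

(** An unordered list of breakpoints which need not be minimal: two functions can
    thus be given a common list, and points where a divisor has chips can be
    added to it. *)
Definition broken_at g B : Prop := forall a b, 0 <= a -> a < b -> b <= 1 ->
  {in B, forall c, ~~ (a < c < b)} -> exists k, slope_on g k a b.

Lemma broken_at_sub g B B' : {subset B <= B'} -> broken_at g B -> broken_at g B'.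
Proof. by move=> BB' gB a b a0 ab b1 H; apply: gB => // c /BB'; apply: H. Qed.

Lemma broken_atB g h B :
  broken_at g B -> broken_at h B -> broken_at (g \- h) B.
Proof.
move=> gB hB a b a0 ab b1 H.
have [k gk] := gB _ _ a0 ab b1 H; have [l hl] := hB _ _ a0 ab b1 H.
by exists (k - l); apply: slope_onB.
Qed.

(** The breakpoints of a partition suffice: an interval that contains none of
    them lies in one piece. *)
Lemma broken_at_path g a0 s :
  (forall I, I \in zip (a0 :: s) s -> exists k c,
     {in `[I.1, I.2], forall t, g t = k%:~R * t + c}) ->
  forall a b, a0 <= a -> a < b -> b <= last a0 s ->
  {in s, forall c, ~~ (a < c < b)} -> exists k, slope_on g k a b.
Proof.
elim: s a0 => [|a1 s IH] a0 /= gs a b a0a ab bl H; first by lra.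
have [b1|b1] := leP b a1.
  have [k [c gk]] := gs (a0, a1) (mem_head _ _); exists k => t.
  rewrite in_itv /= => /andP[t1 t2].
  rewrite !gk ?in_itv /=; [ring| |]; apply/andP; split; lra.
apply: (IH a1) => //; last by move=> c cs; apply: H; rewrite inE cs orbT.
- by move=> I Is; apply: gs; rewrite inE Is orbT.
- have := H a1 (mem_head _ _); rewrite b1 andbT -leNgt; lra.
Qed.

Lemma zip_path a0 s a b : path <%R a0 s -> (a, b) \in zip (a0 :: s) s ->
  [/\ a0 <= a, a < b, b <= last a0 s & {in s, forall c, ~~ (a < c < b)}].
Proof.
elim: s a0 => [|a1 s IH] a0 //= /andP[a01 ps]; rewrite inE => /orP[/eqP[-> ->]|].
  split=> //; first by apply: path_le_last => //; exact: mem_head.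
  move=> c; rewrite inE => /orP[/eqP->|cs]; first by rewrite ltxx andbF.
  move: ps; rewrite lt_path_sortedE => /andP[/allP/(_ c cs) a1c _].
  by rewrite (lt_gtF a1c) andbF.
move=> /(IH _ ps)[a1a ab bl H]; split=> //; first by lra.
move=> c; rewrite inE => /orP[/eqP->|/H //]; by rewrite ltNge a1a.
Qed.

Lemma unit_partition B : exists s, [/\ path <%R 0 s, last 0 s = 1 &
  {subset B <= [pred c | (0 < c < 1) ==> (c \in s)]}].
Proof.
pose s := sort <=%R (undup [seq c <- 1 :: B | 0 < c <= 1]).
have memE c : (c \in s) = (c \in 1 :: B) && (0 < c <= 1).
  by rewrite mem_sort mem_undup mem_filter andbC.
have ps : path <%R 0 s.
  rewrite lt_path_sortedE sort_lt_sorted undup_uniq andbT.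
  by apply/allP => c; rewrite memE => /and3P[].
exists s; split=> //.
  apply/eqP; rewrite eq_le; apply/andP; split; last first.
    apply: path_le_last => //; by rewrite inE memE mem_head ltr01 lexx orbT.
  have := mem_last 0 s; rewrite inE => /orP[/eqP->|]; first exact: ler01.
  by rewrite memE => /and3P[].
move=> c cB; rewrite inE /=; apply/implyP => /andP[c0 c1].
by rewrite memE inE cB orbT c0 ltW.
Qed.

Lemma broken_at_zip g B s a b : broken_at g B ->
  path <%R 0 s -> last 0 s = 1 ->
  {subset B <= [pred c | (0 < c < 1) ==> (c \in s)]} ->
  (a, b) \in zip (0 :: s) s -> exists k, slope_on g k a b.
Proof.
move=> gB ps ls Bs abs; have [a0 ab b1 H] := zip_path ps abs.
apply: gB => //; first by rewrite -ls.
move=> c cB; apply/negP => /andP[ac cb].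
have /implyP := Bs c cB; rewrite ls in b1.
have -> : 0 < c < 1 by apply/andP; split; lra.
by move=> /(_ isT)/H; rewrite ac cb.
Qed.

(** The slope jumps at the inner breakpoints only, so the slopes at the two ends
    differ by the sum of the jumps. *)
Lemma slope_telescope g a0 a1 s : path <%R a0 (a1 :: s) ->
  (forall I, I \in zip [:: a0, a1 & s] (a1 :: s) ->
     exists k, slope_on g k I.1 I.2) ->
  left_slope g (last a1 s) = right_slope g a0
    - \sum_(t <- belast a1 s) (left_slope g t - right_slope g t).
Proof.
elim: s a0 a1 => [|a2 s IH] a0 a1.
  move=> /=/andP[a01 _] /(_ _ (mem_head _ _))[k /= gk].
  by rewrite big_nil (slope_on_left a01 gk) (slope_on_right a01 gk) subr0.
rewrite [path _ _ _]/= => /andP[a01 ps] gs.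
have [k gk] := gs _ (mem_head _ _).
rewrite (IH a1 a2) //; last by move=> I Is; apply: gs; rewrite inE Is orbT.
rewrite [belast a1 _]/= big_cons (slope_on_left a01 gk) (slope_on_right a01 gk).
ring.
Qed.

(** If [d t] bounds how much the slope may increase at [t], then no slope on the
    way exceeds the initial one by more than the sum of [d], and the mean slope
    does not either. *)
Lemma slope_bound g (d : R -> int) a0 a1 s : path <%R a0 (a1 :: s) ->
  (forall I, I \in zip [:: a0, a1 & s] (a1 :: s) ->
     exists k, slope_on g k I.1 I.2) ->
  {in belast a1 s, forall t, 0 <= d t /\ right_slope g t <= left_slope g t + d t} ->
  g (last a1 s) - g a0 <=
    (right_slope g a0 + \sum_(t <- belast a1 s) d t)%:~R * (last a1 s - a0).
Proof.
elim: s a0 a1 => [|a2 s IH] a0 a1.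
  move=> /=/andP[a01 _] /(_ _ (mem_head _ _))[k /= gk] _.
  rewrite big_nil (slope_on_right a01 gk) addr0 gk; last first.
    by rewrite in_itv /= lexx ltW.
  lra.
rewrite [path _ _ _]/= => /andP[a01 ps] gs; rewrite [belast a1 _]/= => H.
have [k gk] := gs _ (mem_head _ _).
have [d1 r1] := H a1 (mem_head _ _).
have {IH} := IH a1 a2 ps; rewrite [last a1 _]/= big_cons.
set l := last a2 s; set S := \sum_(_ <- _) _ => IH.
have /IH {IH} : forall I, I \in zip [:: a1, a2 & s] (a2 :: s) ->
    exists k, slope_on g k I.1 I.2.
  by move=> I Is; apply: gs; rewrite inE Is orbT.
have H' : {in belast a2 s, forall t,
    0 <= d t /\ right_slope g t <= left_slope g t + d t}.
  by move=> t ts; apply: H; rewrite inE ts orbT.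
move=> /(_ H') IH.
have S0 : 0 <= S by rewrite /S big_seq; apply: sumr_ge0 => t /H' [].
have a1l : a1 < l.
  move: ps => /andP[a12 ps]; apply: (lt_le_trans a12).
  by apply: path_le_last => //; rewrite mem_head.
rewrite (slope_on_left a01 gk) in r1; rewrite (slope_on_right a01 gk).
have g1 : g a1 = g a0 + k%:~R * (a1 - a0) by apply: gk; rewrite in_itv /= lexx ltW.
have K1 : (right_slope g a1 + S)%:~R <= (k + (d a1 + S))%:~R :> R.
  by rewrite ler_int; lia.
have K2 : k%:~R <= (k + (d a1 + S))%:~R :> R by rewrite ler_int; lia.
rewrite /= in a01.
have := ler_wpM2r (ltW (_ : 0 < l - a1)) K1; rewrite subr_gt0 => /(_ a1l) ?.
have := ler_wpM2r (ltW (_ : 0 < a1 - a0)) K2; rewrite subr_gt0 => /(_ a01) ?.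
lra.
Qed.

End PiecewiseLinear.

Section Slopes.
Variable R : realType.
Implicit Types (g h : R -> R) (B : seq R) (t a b c : R).

(** Just after [t] there is an interval without breakpoints, on which functions
    broken at [B] are affine. *)
Lemma gap_right B t : t < 1 ->
  exists b, [/\ t < b, b <= 1 & {in B, forall c, ~~ (t < c < b)}].
Proof.
move=> t1; elim: B => [|c B [b [tb b1 H]]]; first by exists 1.
have [/andP[tc cb]|Hc] := boolP (t < c < b).
  exists c; split=> [//||x]; first by apply: ltW; apply: lt_le_trans b1.
  rewrite inE => /orP[/eqP->|/H Hx]; first by rewrite ltxx andbF.
  by apply: contra Hx => /andP[-> xc]; apply: lt_trans cb.
by exists b; split=> // x; rewrite inE => /orP[/eqP->|/H].
Qed.

Lemma gap_left B t : 0 < t ->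
  exists a, [/\ 0 <= a, a < t & {in B, forall c, ~~ (a < c < t)}].
Proof.
move=> t0; elim: B => [|c B [a [a0 at_ H]]]; first by exists 0.
have [/andP[ac ct]|Hc] := boolP (a < c < t).
  exists c; split=> [|//|x]; first by apply: ltW; apply: le_lt_trans ac.
  rewrite inE => /orP[/eqP->|/H Hx]; first by rewrite ltxx.
  by apply: contra Hx => /andP[cx ->]; rewrite andbT; apply: lt_trans cx.
by exists a; split=> // x; rewrite inE => /orP[/eqP->|/H].
Qed.

Lemma right_slopeB g h B t : broken_at g B -> broken_at h B -> 0 <= t < 1 ->
  right_slope (g \- h) t = right_slope g t - right_slope h t.
Proof.
move=> gB hB /andP[t0 t1]; have [b [tb b1 H]] := gap_right B t1.
have [k gk] := gB _ _ t0 tb b1 H; have [l hl] := hB _ _ t0 tb b1 H.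
rewrite (slope_on_right tb gk) (slope_on_right tb hl).
exact: slope_on_right tb (slope_onB gk hl).
Qed.

Lemma left_slopeB g h B t : broken_at g B -> broken_at h B -> 0 < t <= 1 ->
  left_slope (g \- h) t = left_slope g t - left_slope h t.
Proof.
move=> gB hB /andP[t0 t1]; have [a [a0 at_ H]] := gap_left B t0.
have [k gk] := gB _ _ a0 at_ t1 H; have [l hl] := hB _ _ a0 at_ t1 H.
rewrite (slope_on_left at_ gk) (slope_on_left at_ hl).
exact: slope_on_left at_ (slope_onB gk hl).
Qed.

End Slopes.

(** * Divisors and rational functions on a metric graph *)

Section MetricGraph.
Variables (R : realType) (G : multigraph).
Implicit Types (phi psi : mpoint R G -> R) (D E : divisor R G) (e : edge G).

Lemma edge_point0 e : edge_point e 0 = inl (source e) :> mpoint R G.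
Proof. by rewrite /edge_point insubN ?ltxx // lexx. Qed.

Lemma edge_point1 e : edge_point e 1 = inl (target e) :> mpoint R G.
Proof. by rewrite /edge_point insubN ?ltxx ?andbF // lt_geF ?ltr01. Qed.

Lemma edge_pointE e (t : {t : R | 0 < t < 1}) : edge_point e (val t) = inr (e, t).
Proof. by rewrite /edge_point valK. Qed.

Lemma rational_broken phi e : rational_function phi ->
  exists B, broken_at (on_edge phi e) B.
Proof.
move=> /(_ e)[_ [s [ps ls H]]]; exists s => a b a0 ab b1.
by apply: (broken_at_path H); rewrite ?ls.
Qed.

Lemma rational_broken2 phi psi e :
  rational_function phi -> rational_function psi ->
  exists B, broken_at (on_edge phi e) B /\ broken_at (on_edge psi e) B.
Proof.
move=> /(rational_broken e)[B1 H1] /(rational_broken e)[B2 H2].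
exists (B1 ++ B2); split; [move: H1|move: H2]; apply: broken_at_sub => c cB;
  by rewrite mem_cat cB ?orbT.
Qed.

Lemma rational_functionP phi :
  (forall e, {within `[0, 1], continuous (on_edge phi e)} /\
    exists B, broken_at (on_edge phi e) B) -> rational_function phi.
Proof.
move=> H e; have [Hc [B HB]] := H e; split=> //.
have [s [ps ls Bs]] := unit_partition B; exists s; split=> // -[a b] abI /=.
have [k gk] := broken_at_zip HB ps ls Bs abI.
exists k, (on_edge phi e a - k%:~R * a) => t /gk ->; ring.
Qed.

Lemma rational_functionB phi psi :
  rational_function phi -> rational_function psi ->
  rational_function (phi \- psi).
Proof.
move=> Hphi Hpsi; apply: rational_functionP => e.
have [B [B1 B2]] := rational_broken2 e Hphi Hpsi.
split; last by exists B; apply: (broken_atB B1 B2).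
move=> t; apply: cvgB; [exact: (Hphi e).1|exact: (Hpsi e).1].
Qed.

Lemma ordB phi psi p : rational_function phi -> rational_function psi ->
  ord (phi \- psi) p = ord phi p - ord psi p.
Proof.
move=> Hphi Hpsi.
have slB e t : 0 < t <= 1 -> left_slope (on_edge (phi \- psi) e) t =
    left_slope (on_edge phi e) t - left_slope (on_edge psi e) t.
  have [B [B1 B2]] := rational_broken2 e Hphi Hpsi; exact: left_slopeB B1 B2.
have srB e t : 0 <= t < 1 -> right_slope (on_edge (phi \- psi) e) t =
    right_slope (on_edge phi e) t - right_slope (on_edge psi e) t.
  have [B [B1 B2]] := rational_broken2 e Hphi Hpsi; exact: right_slopeB B1 B2.
case: p => [x|[e [t /= /andP[t0 t1]]]] /=; last first.
  rewrite slB ?t0 ?(ltW t1) // srB ?t1 ?(ltW t0) //; ring.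
under eq_bigr => e _ do rewrite slB ?ltr01 ?lexx //.
under [X in _ - X]eq_bigr => e _ do rewrite srB ?ltr01 ?lexx //.
by rewrite !sumrB !opprD !opprK addrACA.
Qed.

(** [phi] witnesses that [D] and [D'] are equivalent; the witness is kept because
    the arguments below compare its values and slopes. *)
Definition moves phi D D' : Prop :=
  rational_function phi /\ forall p, coeff p (D' - D) = ord phi p.

(** Two divisors equivalent to a third one are equivalent, and the witness is the
    difference: effective divisors in one class can be compared directly. *)
Lemma movesB phi psi D D1 D2 : moves phi D D1 -> moves psi D D2 ->
  moves (psi \- phi) D1 D2.
Proof.
move=> [rphi Dphi] [rpsi Dpsi]; split; first exact: rational_functionB.
by move=> p; rewrite ordB // -Dphi -Dpsi !coeffB; ring.
Qed.

Definition chips D e : int :=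
  \sum_(p <- dom D | if p is inr (e', _) then e' == e else false) coeff p D.

Lemma chips_ge0 D e : effective D -> 0 <= chips D e.
Proof. by move=> effD; apply: sumr_ge0. Qed.

Lemma chipsE D e (l : seq R) : uniq l -> {in l, forall t, 0 < t < 1} ->
  (forall t, inr (e, t) \in dom D -> val t \in l) ->
  chips D e = \sum_(t <- l) coeff (edge_point e t) D.
Proof.
move=> ul l01 Dl; rewrite -(big_map (edge_point e) predT (fun p => coeff p D)).
rewrite [RHS](bigID [pred p | coeff p D != 0]) /= [X in _ + X]big1 ?addr0; last first.
  by move=> p /negbNE/eqP.
rewrite /chips -[LHS]big_filter -[RHS]big_filter; apply: (perm_big (I := mpoint R G)).
apply: uniq_perm.
- exact/filter_uniq/uniq_dom.
- apply/filter_uniq; rewrite map_inj_in_uniq // => t t' tl t'l.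
  have [u ut] : exists u : {t : R | 0 < t < 1}, val u = t.
    by exists (exist _ t (l01 _ tl)).
  have [u' ut'] : exists u : {t : R | 0 < t < 1}, val u = t'.
    by exists (exist _ t' (l01 _ t'l)).
  by rewrite -ut -ut' !edge_pointE => -[->].
move=> p; rewrite !mem_filter mem_dom /= andbC; case: eqVneq => //= Dp.
apply/idP/mapP => [|[t tl ->]].
  case: p Dp => [//|[e' t]] Dp /eqP e'e; rewrite {e'}e'e in Dp *.
  by exists (val t); [apply: Dl; rewrite mem_dom|rewrite edge_pointE].
by have := edge_pointE e (exist _ t (l01 _ tl)); rewrite /= => ->.
Qed.

Lemma deg_sum D : deg D = \sum_(p <- dom D) coeff p D.
Proof.
rewrite -[in LHS](freeg_sumE D) raddf_sum; apply: eq_bigr => p _; exact: degU.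
Qed.

Lemma deg_vertices_chips D :
  deg D = \sum_x coeff (inl x) D + \sum_e chips D e.
Proof.
have coeffE p : coeff p D = \sum_(q <- dom D) if q == p then coeff q D else 0.
  have [pD|pD] := boolP (p \in dom D); last first.
    rewrite coeff_outdom // big_seq big1 // => q qD.
    by case: eqP => // qp; rewrite -qp qD in pD.
  rewrite (bigD1_seq p) ?uniq_dom //= eqxx big1 ?addr0 // => q /negbTE -> //.
under eq_bigr => x _ do rewrite coeffE.
under [X in _ = _ + X]eq_bigr => e _ do rewrite /chips big_mkcond.
rewrite deg_sum exchange_big [X in _ + X]exchange_big -big_split /=.
apply: eq_bigr => -[x|[e t]] _.
  rewrite [X in _ + X]big1 // addr0 (bigD1 x) //= eqxx big1 ?addr0 // => y yx.
  by case: eqP => // -[xy]; rewrite xy eqxx in yx.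
rewrite big1 // add0r (bigD1 e) //= eqxx big1 ?addr0 // => e' /negbTE.
by rewrite eq_sym => ->.
Qed.

(** A partition of [e] fine enough for both the breaks of [phi] and the supports
    of [D] and [D'] turns all statements about [e] into finite sums. *)
Lemma moves_partition phi D D' e : moves phi D D' ->
  exists (a : R) (s : seq R), [/\ path <%R 0 (a :: s), last a s = 1,
    forall I, I \in zip [:: 0, a & s] (a :: s) ->
      exists k, slope_on (on_edge phi e) k I.1 I.2,
    {in [:: D; D'], forall F : divisor R G,
       chips F e = \sum_(t <- belast a s) coeff (edge_point e t) F} &
    {in belast a s, forall t, coeff (edge_point e t) D' - coeff (edge_point e t) D =
       left_slope (on_edge phi e) t - right_slope (on_edge phi e) t}].
Proof.
move=> [/(rational_broken e)[B HB] Hord].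
(* The value 0 at vertices is harmless, as it is not inside the interval. *)
pose pos (p : mpoint R G) : R := if p is inr (_, t) then val t else 0.
have [[|a s] [ps ls]] := unit_partition (B ++ map pos (dom D ++ dom D')).
  by have := oner_neq0 R; rewrite -ls eqxx.
move=> sub; rewrite [last _ _]/= in ls; exists a, s.
have subB : {subset B <= [pred c | (0 < c < 1) ==> (c \in a :: s)]}.
  by move=> c cB; apply: sub; rewrite mem_cat cB.
have uas : uniq (rcons (belast a s) (last a s)).
  rewrite -lastI; apply: lt_sorted_uniq.
  by move: ps; rewrite lt_path_sortedE => /andP[].
have inner : {in belast a s, forall t, 0 < t < 1}.
  move=> t ts; have tas : t \in a :: s by rewrite lastI mem_rcons inE ts orbT.
  move: (ps); rewrite lt_path_sortedE => /andP[/allP/(_ t tas) -> _] /=.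
  have tl : t <= 1 by rewrite -ls; apply: (path_le_last ps); rewrite inE tas orbT.
  rewrite lt_neqAle tl andbT -ls.
  by apply: contraTneq uas => <-; rewrite rcons_uniq ts.
have dom_inner F : {subset dom F <= dom D ++ dom D'} ->
    forall t, inr (e, t) \in dom F -> val t \in belast a s.
  move=> Fsub t /Fsub tF; have /= t01 := valP t.
  have : val t \in [pred c | (0 < c < 1) ==> (c \in a :: s)].
    by apply: sub; rewrite mem_cat; apply/orP; right; apply/mapP; exists (inr (e, t)).
  rewrite inE t01 lastI mem_rcons inE ls /= => /orP[/eqP t1|//].
  by move: t01 => /andP[_]; rewrite t1 ltxx.
split=> //.
- by move=> [b c] /(broken_at_zip HB ps ls subB).
- move=> F FD; apply: chipsE => //; first by move: uas; rewrite rcons_uniq => /andP[].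
  apply: dom_inner => p; rewrite mem_cat.
  by move: FD; rewrite !inE => /orP[]/eqP-> ->; rewrite ?orbT.
move=> t /inner t01; rewrite -coeffB.
by have := edge_pointE e (exist _ t t01) => /= ->; rewrite Hord.
Qed.

(** The chips that enter an edge through its ends are accounted for by the slopes
    there. *)
Lemma moves_chips phi D D' e : moves phi D D' ->
  chips D' e - chips D e =
    right_slope (on_edge phi e) 0 - left_slope (on_edge phi e) 1.
Proof.
move=> /(moves_partition e)[a [s [ps ls Hs HD H]]].
rewrite !HD ?inE ?eqxx ?orbT // -sumrB -ls (slope_telescope ps Hs).
by rewrite big_seq [in RHS]big_seq (eq_bigr _ H); ring.
Qed.

(** Along [e] the slope of [phi] increases only where [D] has chips, because [D']
    is effective.  So if [phi] rises from source to target, then its initial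
    slope plus the number of chips is positive, hence at least 1, both being
    integers. *)
Lemma moves_rise phi D D' e : moves phi D D' -> effective D -> effective D' ->
  phi (inl (target e)) - phi (inl (source e)) <=
    (right_slope (on_edge phi e) 0 + chips D e)%:~R.
Proof.
move=> /(moves_partition e)[a [s [ps ls Hs HD H]]] D0 D'0.
rewrite HD ?mem_head //.
have := slope_bound (d := fun t => coeff (edge_point e t) D) ps Hs.
rewrite ls subr0 mulr1 /on_edge edge_point0 edge_point1; apply.
move=> t ts; split; first exact: D0.
by have := H t ts; have := D'0 (edge_point e t); rewrite /on_edge; lia.
Qed.

(** A principal divisor has degree 0: each edge contributes to the orders at its
    two ends the opposite of what it contributes in its interior. *)
Lemma moves_deg phi D D' : moves phi D D' -> deg D' = deg D.
Proof.
move=> mv; apply/eqP; rewrite -subr_eq0 !deg_vertices_chips opprD addrACA -!sumrB.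
have -> : \sum_x (coeff (inl x) D' - coeff (inl x) D) = \sum_x ord phi (inl x).
  by apply: eq_bigr => x _; rewrite -coeffB mv.2.
rewrite (eq_bigr _ (fun e _ => moves_chips e mv)) /= !sumrB.
have sum1 (h : edge G -> vertex G) (F : edge G -> int) :
    \sum_x \sum_(e | h e == x) F e = \sum_e F e.
  rewrite (exchange_big_dep xpredT) //=; apply: eq_bigr => e _.
  by rewrite (big_pred1 (h e)) // => x; rewrite eq_sym.
rewrite !sum1; apply/eqP; ring.
Qed.

End MetricGraph.

(** * The gonality of a staircase *)

(** The combinatorial core of the lower bound.  The index [i] runs through a
    family of equivalent effective divisors.  [c k i] is the number of chips at
    vertex [k], [x k i] the number of chips inside the edges from [k] to [k + 1],
    [outs k i] and [ins k.+1 i] are the sums of the slopes of the rational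
    function number [i] at the two ends of these edges, and [u k i] is its value
    at vertex [k].  The divisor number [at_ k] has a chip at [k]. *)
Lemma staircase_bound (R : realDomainType) (I : Type) (N : nat) (at_ : nat -> I)
    (c x outs ins : nat -> I -> int) (u : nat -> I -> R) :
  (forall k i, 0 <= c k i) -> (forall k i, 0 <= x k i) ->
  (forall k, (k <= N)%N -> 1 <= c k (at_ k)) ->
  (forall k i j, (k <= N)%N ->
     c k j - c k i = (ins k j - ins k i) - (outs k j - outs k i)) ->
  (forall k i j, (k < N)%N ->
     x k j - x k i = (outs k j - outs k i) - (ins k.+1 j - ins k.+1 i)) ->
  (forall i, outs N i = 0) ->
  (forall k i j, (k < N)%N -> 0 <= (u k.+1 j - u k j) - (u k.+1 i - u k i) ->
     0 <= outs k j - outs k i + x k i) ->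
  (forall k i j, (k < N)%N -> 0 < (u k.+1 j - u k j) - (u k.+1 i - u k i) ->
     k.+1%:Z <= outs k j - outs k i + x k i) ->
  exists i, N%:Z <= \sum_(k < N) (c k i + x k i) + c N i.
Proof.
move=> c0 x0 c1 dc dx outN rise0 rise1; apply: contrapT => /forallNP small.
(* The chips that vertex k gets when the vertices beyond k are removed, computed
   so that at_ k.+1 hands over exactly its chips inside the edges. *)
pose y k i : int :=
  if (k < N)%N then outs k i - outs k (at_ k.+1) + x k (at_ k.+1) else 0.
suff H k : (k <= N)%N -> forall i, 0 <= y k i /\
    \sum_(l < k) (c l i + x l i) + c k i + y k i < k%:Z.
  have [y0 ] := H 0%N (leq0n N) (at_ 0%N).
  by rewrite big_ord0; have := c0 0%N (at_ 0%N); lia.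
move=> kN; rewrite -(subKn kN); elim: (N - k)%N => [|d IH] i.
  rewrite subn0 /y ltnn addr0; split=> //.
  by have := small i; lia.
have [dN|Nd] := ltnP d N; last first.
  by have := IH i; rewrite (_ : N - d.+1 = N - d)%N //; lia.
have Ed : (N - d)%N = (N - d.+1).+1 by lia.
rewrite {}Ed in IH.
have : (N - d.+1 < N)%N by lia.
move: (N - d.+1)%N IH => {kN dN}l IH lN.
have sum0 j : 0 <= \sum_(h < l) (c h j + x h j).
  by apply: sumr_ge0 => h _; have := c0 h j; have := x0 h j; lia.
(* On the remaining staircase the balance at the last vertex involves the
   incoming edges only. *)
have dcy i' j : c l.+1 j + y l.+1 j - (c l.+1 i' + y l.+1 i') =
    ins l.+1 j - ins l.+1 i'.
  have := dc l.+1 i' j lN; rewrite /y; case: ltnP => [_|Nl]; first by lia.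
  have -> : l.+1 = N by lia.
  by rewrite !outN; lia.
(* No function of the family tells vertex l.+1 from vertex l. *)
have flat i' j : (u l.+1 j - u l j) - (u l.+1 i' - u l i') <= 0.
  rewrite leNgt; apply/negP => /(rise1 l i' j lN).
  have := dx l i' j lN; have := dcy i' j.
  have [y1 _] := IH i'; have [_] := IH j; rewrite big_ord_recr /=.
  have := sum0 j; have := c0 l j; have := c0 l.+1 i'; lra.
have yl : 0 <= y l i.
  rewrite /y lN; apply: rise0 => //; have := flat i (at_ l.+1).
  by rewrite -oppr_ge0 !opprB.
split=> //; have [y1] := IH i; rewrite big_ord_recr /=.
have := dx l (at_ l.+1) i lN; have := dcy (at_ l.+1) i.
have := c1 l.+1 lN; have [y2 _] := IH (at_ l.+1).
rewrite [y l i]/y lN intS.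
by move: (\sum_(_ < l) _) => S; lia.
Qed.

Section Staircase.
Variables (R : realType) (G : multigraph) (N : nat).
Implicit Types (D E : divisor R G) (e : edge G) (x : vertex G).

(** The positions of the vertices are given by [pos]; [k + 1] edges of length 1 go
    from position [k] to position [k + 1]. *)
Definition staircase (pos : vertex G -> 'I_N.+1) : Prop :=
  [/\ bijective pos, forall e, pos (target e) = (pos (source e)).+1 :> nat
    & forall k, (k < N)%N -> #|[pred e | pos (source e) == k :> nat]| = k.+1].

Lemma rank_ge1_chip D p : rank_ge D 1 ->
  exists D' phi, [/\ moves phi D D', effective D' & 1 <= coeff p D'].
Proof.
move=> /(_ << p >>)[||D' [effD' [phi rphi Hphi]]].
- by move=> q; rewrite coeffU mul1r.
- by rewrite degU.
have effE q : 0 <= coeff q (<< p >> : divisor R G) by rewrite coeffU mul1r.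
exists (D' + << p >>), phi; split.
- by split=> // q; rewrite -Hphi !coeffB coeffD; ring.
- by move=> q; rewrite coeffD addr_ge0.
by rewrite coeffD coeffU eqxx mulr1; have := effD' p; lia.
Qed.

Lemma effective_deg_ge0 D : effective D -> 0 <= deg D.
Proof. by move=> effD; rewrite deg_sum; apply: sumr_ge0. Qed.

(** The data for [staircase_bound] come from one divisor [F i] with a chip at
    vertex [i] for each [i], all in the class of [D]; the bounds on slopes are
    [moves_rise] summed over parallel edges. *)
Lemma staircase_deg_ge (pos : vertex G -> 'I_N.+1) D :
  staircase pos -> rank_ge D 1 -> N%:Z <= deg D.
Proof.
move=> [[at_ posK atK] posE posC] rD.
have /choice[F HF] : forall i : 'I_N.+1, exists DF : divisor R G * (mpoint R G -> R),
    [/\ moves DF.2 D DF.1, effective DF.1 & 1 <= coeff (inl (at_ i)) DF.1].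
  move=> i; have [D' [phi H]] := rank_ge1_chip (inl (at_ i)) rD.
  by exists (D', phi).
pose V k := at_ (inord k).
pose slope0 i e := right_slope (on_edge (F i).2 e) 0.
pose slope1 i e := left_slope (on_edge (F i).2 e) 1.
have posV k : (k <= N)%N -> pos (V k) = k :> nat by move=> kN; rewrite atK inordK.
have sourceV k e : (pos (source e) == k :> nat) -> source e = V k.
  by move=> /eqP <-; rewrite /V inord_val posK.
have targetV k e : (pos (target e) == k :> nat) -> target e = V k.
  by move=> /eqP <-; rewrite /V inord_val posK.
have predV (h : edge G -> vertex G) k e : (k <= N)%N ->
    (h e == V k) = (pos (h e) == k :> nat).
  move=> kN; apply/eqP/eqP => [->|<-]; first exact: posV.
  by rewrite /V inord_val posK.
have slopeB i j e : right_slope (on_edge ((F j).2 \- (F i).2) e) 0 =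
    slope0 j e - slope0 i e.
  have [[ri _] _ _] := HF i; have [[rj _] _ _] := HF j.
  have [B [B1 B2]] := rational_broken2 e rj ri.
  by apply: (right_slopeB B1 B2); rewrite lexx ltr01.
have rise i j e k : (k < N)%N -> (pos (source e) == k :> nat) ->
    ((F j).2 (inl (V k.+1)) - (F j).2 (inl (V k))) -
    ((F i).2 (inl (V k.+1)) - (F i).2 (inl (V k))) <=
    (slope0 j e - slope0 i e + chips (F i).1 e)%:~R.
  move=> kN ek; have [mi effi _] := HF i; have [mj effj _] := HF j.
  have := moves_rise e (movesB mi mj) effi effj.
  rewrite slopeB (sourceV _ _ ek) (targetV k.+1 e) /=; last by rewrite posE (eqP ek).
  by apply: le_trans; rewrite le_eqVlt; apply/orP; left; apply/eqP; ring.
have [||||||||i] := @staircase_bound R 'I_N.+1 N inord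
  (fun k i => coeff (inl (V k)) (F i).1)
  (fun k i => \sum_(e | pos (source e) == k :> nat) chips (F i).1 e)
  (fun k i => \sum_(e | pos (source e) == k :> nat) slope0 i e)
  (fun k i => \sum_(e | pos (target e) == k :> nat) slope1 i e)
  (fun k i => (F i).2 (inl (V k))).
- by move=> k i; have [_ eff _] := HF i; apply: eff.
- by move=> k i; have [_ eff _] := HF i; apply: sumr_ge0 => e _; apply: chips_ge0.
- by move=> k kN; have [_ _] := HF (inord k).
- move=> k i j kN; have [mi _ _] := HF i; have [mj _ _] := HF j.
  have [_ Hij] := movesB mi mj; have := Hij (inl (V k)).
  rewrite coeffB (ordB _ mj.1 mi.1) => ->.
  rewrite /ord /= !(eq_bigl _ _ (fun e => predV _ k e kN)).
  by rewrite !opprD !opprK addrACA.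
- move=> k i j kN.
  have balance h : \sum_(e | pos (source e) == k :> nat) chips (F h).1 e -
      \sum_(e | pos (source e) == k :> nat) chips D e =
      \sum_(e | pos (source e) == k :> nat) slope0 h e -
      \sum_(e | pos (target e) == k.+1 :> nat) slope1 h e.
    have [mh _ _] := HF h.
    have -> : \sum_(e | pos (target e) == k.+1 :> nat) slope1 h e =
        \sum_(e | pos (source e) == k :> nat) slope1 h e.
      by apply: eq_bigl => e; rewrite posE eqSS.
    rewrite -!sumrB; apply: eq_bigr => e _; exact: moves_chips.
  have := balance i; have := balance j; lia.
- move=> i; apply: big1 => e /eqP eN.
  by have := ltn_ord (pos (target e)); rewrite posE eN ltnn.
- move=> k i j kN uij; rewrite -sumrB -big_split /=; apply: sumr_ge0 => e ek.
  by rewrite -(ler0z R); apply: le_trans uij (rise _ _ _ _ kN ek).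
- move=> k i j kN uij; rewrite -sumrB -big_split /= -(posC k kN) -sum1_card.
  rewrite -natz natr_sum; apply: ler_sum => e ek.
  have : 0 < (slope0 j e - slope0 i e + chips (F i).1 e)%:~R :> R.
    exact: lt_le_trans uij (rise _ _ _ _ kN ek).
  by rewrite ltr0z gtz0_ge1.
have [mi _ _] := HF i; rewrite -(moves_deg mi) deg_vertices_chips => H.
apply: (le_trans H); rewrite big_split /= addrAC.
have -> : \sum_x coeff (inl x) (F i).1 =
    \sum_(k < N) coeff (inl (V k)) (F i).1 + coeff (inl (V N)) (F i).1.
  rewrite -(big_ord_recr N (fun k => coeff (inl (V k)) (F i).1)) /=.
  rewrite (reindex at_) /=; last by exists pos.
  by apply: eq_bigr => k _; rewrite /V inord_val.
rewrite lerD2l.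
rewrite (exchange_big_dep xpredT) //= le_eqVlt; apply/orP; left; apply/eqP.
apply: eq_bigr => e _.
have eN : (pos (source e) < N)%N by rewrite -ltnS -posE ltn_ord.
by rewrite (big_pred1 (Ordinal eN)) // => k; rewrite eq_sym.
Qed.

Lemma divisor_of_support (K : choiceType) (s : seq K) (F : K -> int) :
  (forall p, F p != 0 -> p \in s) ->
  exists D : {freeg K / int}, forall p, coeff p D = F p.
Proof.
move=> Fs; exists (\sum_(q <- undup s) << F q *g q >>) => p.
rewrite raddf_sum /=; have [ps|ps] := boolP (p \in s).
  rewrite (bigD1_seq p) ?undup_uniq ?mem_undup //= coeffU eqxx mulr1 big1 ?addr0 //.
  by move=> q /negbTE qp; rewrite coeffU qp mulr0.
rewrite big_seq big1 => [|q].
  by apply/esym/eqP; apply: contraNT ps => /Fs.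
rewrite mem_undup coeffU => qs; case: eqP => [qp|]; last by rewrite mulr0.
by rewrite -qp qs in ps.
Qed.

Section Level.
Variables (pos : vertex G -> 'I_N.+1) (tau : R).
Hypothesis pos_staircase : staircase pos.

Definition level (p : mpoint R G) : R :=
  match p with
  | inl x => (pos x)%:R
  | inr (e, t) => (pos (source e))%:R + val t
  end.

(** Flat below level [tau] and of slope -1 beyond: adding its divisor fires
    everything beyond level [tau]. *)
Definition sweep p : R := - Num.max (level p) tau.

Lemma level_edge e t : 0 <= t <= 1 -> level (edge_point e t) = (pos (source e))%:R + t.
Proof.
have [_ posE _] := pos_staircase.
move=> /andP[]; rewrite le_eqVlt => /orP[/eqP<- _|t0].
  by rewrite edge_point0 /= addr0.
rewrite le_eqVlt => /orP[/eqP->|t1]; first by rewrite edge_point1 /= posE -natr1.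
have t01 : 0 < t < 1 by rewrite t0.
by have := edge_pointE e (exist _ t t01) => /= ->.
Qed.

Let base e : R := (pos (source e))%:R.

Lemma on_edge_sweep e t : 0 <= t <= 1 ->
  on_edge sweep e t = - Num.max (base e + t) tau.
Proof. by move=> t01; rewrite /on_edge /sweep level_edge. Qed.

Lemma sweep_before e a b : 0 <= a -> b <= 1 -> base e + b <= tau ->
  slope_on (on_edge sweep e) 0 a b.
Proof.
move=> a0 b1 bt t; rewrite in_itv /= => /andP[ta tb].
rewrite mul0r addr0 !on_edge_sweep ?max_r //; try (apply/andP; split); lra.
Qed.

Lemma sweep_after e a b : 0 <= a -> b <= 1 -> tau <= base e + a ->
  slope_on (on_edge sweep e) (-1) a b.
Proof.
move=> a0 b1 bt t; rewrite in_itv /= => /andP[ta tb].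
rewrite !on_edge_sweep ?max_l; try (apply/andP; split); lra.
Qed.

Lemma rational_sweep : rational_function sweep.
Proof.
apply: rational_functionP => e; split.
  apply: (@subspace_eq_continuous _ _ _ (fun t => - Num.max (base e + t) tau)).
    move=> t; rewrite inE /= in_itv /= => t01; exact/esym/on_edge_sweep.
  apply: continuous_subspaceT => t; apply: cvgN.
  apply: (@continuous_max _ _ (fun t : R => base e + t) (cst tau)).
    by apply: cvgD; [exact: cvg_cst|exact: cvg_id].
  exact: cvg_cst.
exists [:: tau - base e] => a b a0 ab b1 /(_ _ (mem_head _ _)).
have [bt _|tb] := leP (base e + b) tau; first by exists 0; apply: sweep_before.
move=> H; exists (-1); apply: sweep_after => //.
by move: H; rewrite ltrBlDl tb andbT -leNgt; lra.
Qed.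

Lemma right_sweep e t : 0 <= t < 1 ->
  right_slope (on_edge sweep e) t = - (tau <= base e + t)%R%:R.
Proof.
move=> /andP[t0 t1]; have [tt|tt] := leP tau (base e + t).
  by apply: (slope_on_right t1); apply: sweep_after.
have [b [tb b1 bt]] : exists b, [/\ t < b, b <= 1 & base e + b <= tau].
  exists (Num.min 1 (tau - base e)); case: (leP 1 (tau - base e)); split; lra.
rewrite oppr0; apply: (slope_on_right tb); exact: sweep_before.
Qed.

Lemma left_sweep e t : 0 < t <= 1 ->
  left_slope (on_edge sweep e) t = - (tau < base e + t)%R%:R.
Proof.
move=> /andP[t0 t1]; have [tt|tt] := ltP tau (base e + t); last first.
  by rewrite oppr0; apply: (slope_on_left t0); apply: sweep_before.
have [a [a0 at_ bt]] : exists a, [/\ 0 <= a, a < t & tau <= base e + a].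
  exists (Num.max 0 (tau - base e)); case: (leP 0 (tau - base e)); split; lra.
apply: (slope_on_left at_); exact: sweep_after.
Qed.

(** The only points inside edges that gain chips are those at level [tau], where
    the slope changes from 0 to -1. *)
Lemma ord_sweep_edge e t :
  ord sweep (inr (e, t)) = (level (inr (e, t)) == tau)%R%:R.
Proof.
have /= /andP[t0 t1] := valP t.
have ls := @left_sweep e (val t); have rs := @right_sweep e (val t).
rewrite /ord ls ?t0 ?(ltW t1) // rs ?t1 ?(ltW t0) // /level -/(base e).
by case: (ltgtP (base e + val t) tau).
Qed.

(** Beyond level [tau] a vertex receives one chip more than it sends down, except
    for the last vertex, which sends down [N]; at level [tau] all the chips sent
    arrive. *)
Lemma ord_sweep_vertex x : ord sweep (inl x) =
  (if pos x < N then (pos x).+1 * (tau <= (pos x)%:R)%R else 0)%N%:Z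
  - ((pos x) * (tau < (pos x)%:R)%R)%N%:Z.
Proof.
have [[at_ posK atK] posE posC] := pos_staircase.
have eq_pos y : (y == x) = (pos y == pos x :> nat).
  by apply/eqP/eqP => [->//|/val_inj/(can_inj posK)].
have sumC k (b : bool) : (k < N)%N ->
    \sum_(e | pos (source e) == k :> nat) (- b%:R : int) = - (k.+1 * b)%N%:Z.
  move=> kN; rewrite sumr_const -mulNrn -mulrnA mulnC -(posC k kN).
  by rewrite mulNrn -natz natrM -mulr_natl mulr_natr.
have -> : ord sweep (inl x) =
    \sum_(e | pos (target e) == pos x :> nat) (- (tau < (pos x)%:R)%R%:R) -
    \sum_(e | pos (source e) == pos x :> nat) (- (tau <= (pos x)%:R)%R%:R).
  rewrite /ord !(eq_bigl _ _ (fun e => eq_pos _)).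
  congr (_ - _); apply: eq_bigr => e /eqP ex.
    by rewrite left_sweep ?ltr01 ?lexx // /base natr1 -posE ex.
  by rewrite right_sweep ?ltr01 ?lexx // /base addr0 ex.
have -> : \sum_(e | pos (target e) == pos x :> nat) (- (tau < (pos x)%:R)%R%:R : int) =
    - (pos x * (tau < (pos x)%:R)%R)%N%:Z.
  case: (nat_of_ord (pos x)) (ltn_ord (pos x)) => [_|k kN].
    by rewrite mul0n big_pred0 // => e; rewrite posE.
  by rewrite -sumC //; apply: eq_bigl => e; rewrite posE eqSS.
case: ltnP => px; first by rewrite sumC // opprK addrC.
rewrite big_pred0 ?subr0 ?sub0r // => e; apply/negP => /eqP ex.
by have := ltn_ord (pos (target e)); rewrite posE ex ltnS ltnNge px.
Qed.

End Level.

(** To get a chip at [p], sweep down to the level of [p]. *)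
Lemma staircase_rank_ge1 (pos : vertex G -> 'I_N.+1) x0 : staircase pos ->
  pos x0 = N :> nat -> rank_ge (<< (maxn 1 N)%:Z *g inl x0 >> : divisor R G) 1.
Proof.
move=> sp px0 E effE degE.
have [p ->] : exists p, E = << p >> by apply: deg1pos => //; apply/fgposP.
set D := (X in linear_system (X - _)); pose phi := sweep pos (level pos p).
have [F FE] : exists F : divisor R G, forall q, coeff q F = ord phi q.
  apply: (@divisor_of_support _ ([seq inl x | x <- enum (vertex G)] ++
      [seq edge_point e (level pos p - (pos (source e))%:R) | e <- enum (edge G)])).
  move=> [x|[e t]] pq; rewrite mem_cat; apply/orP; [left|right].
    by apply/mapP; exists x; rewrite ?mem_enum.
  move: pq; rewrite ord_sweep_edge //; case: (_ =P level pos p) => // /= <- _.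
  apply/mapP; exists e; rewrite ?mem_enum //.
  by rewrite addrAC subrr add0r edge_pointE.
exists (D - << p >> + F); split; last first.
  exists phi => [|q]; first exact: rational_sweep.
  by rewrite -FE !coeffB coeffD coeffB; ring.
move=> q; rewrite coeffD coeffB FE !coeffU mul1r.
case: q => [x|[e t]]; last first.
  rewrite ord_sweep_edge // /D; case: (eqVneq p (inr (e, t))) => [->|_].
    by rewrite eqxx mulr0.
  by rewrite mulr0; case: eqP.
rewrite ord_sweep_vertex //.
have -> : (inl x0 == inl x :> mpoint R G) = (pos x == N :> nat).
  have [[at_ posK _] _ _] := sp.
  apply/eqP/eqP => [[<-]//|xN].
  by congr inl; apply: (can_inj posK); apply: val_inj; rewrite /= xN.
have xN : (pos x <= N)%N by rewrite -ltnS ltn_ord.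
have [->|_] := eqVneq p (inl x).
  by rewrite [level _ _]/= lexx ltxx; case: ltngtP xN; lia.
by case: (ltgtP (level pos p)); case: ltngtP xN; lia.
Qed.

(** Turns the lower bound on divisors of rank at least 1 into one for rank at
    least 2, which shows that the divisor of the upper bound has rank exactly 1. *)
Lemma rank_ge2_sub D p : rank_ge D 2 -> rank_ge (D - << p >>) 1.
Proof.
move=> rD E effE degE; rewrite -addrA -opprD; apply: rD.
  by move=> q; rewrite coeffD coeffU mul1r addr_ge0.
by rewrite degD degU degE.
Qed.

Lemma staircase_gonality (pos : vertex G -> 'I_N.+1) :
  staircase pos -> is_gonality R G (maxn 1 N)%:Z.
Proof.
move=> sp; have [[at_ posK atK] _ _] := sp.
have lower D : rank_ge D 1 -> (maxn 1 N)%:Z <= deg D.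
  move=> rD; have := staircase_deg_ge sp rD.
  have [D' [phi [mv effD' D'1]]] := rank_ge1_chip (inl (at_ ord_max)) rD.
  suff : 1 <= deg D' by rewrite (moves_deg mv); lia.
  rewrite -(subrK << inl (at_ ord_max) >> D') degD degU lerDr.
  apply: effective_deg_ge0 => q; rewrite coeffB coeffU mul1r.
  by case: eqP => [<-|_]; [rewrite subr_ge0|rewrite subr0].
split; last by move=> D [[]//|[n [[<-] /lower]]].
exists (<< (maxn 1 N)%:Z *g inl (at_ ord_max) >>); last by rewrite degU.
right; exists 1%N; split=> //; first by apply: (staircase_rank_ge1 sp); rewrite atK.
move=> /(@rank_ge2_sub _ (inl (at_ ord_max)))/lower.
by rewrite degB !degU; lia.
Qed.

End Staircase.

(** * Convex sets in the plane *)

Section Plane.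
Variable R : realType.
Implicit Types (A P K : set (plane R)) (p q : plane R) (x y t : R).

(** The convex combination of two points, in coordinates. *)
Definition between t p q : plane R :=
  (t * p.1 + (1 - t) * q.1, t * p.2 + (1 - t) * q.2).

Lemma conv_between (t : {i01 R}) p q :
  conv t (p : convex_lmodType (plane R)) q = between t%:num p q.
Proof. by []. Qed.

Lemma convex_setP A : convex_set A <->
  forall p q t, A p -> A q -> 0 <= t <= 1 -> A (between t p q).
Proof.
split=> [cA p q t Ap Aq /andP[t0 t1]|cA p q t].
  have := cA p q (Itv01 t0 t1); rewrite conv_between /= => H.
  by apply/set_mem; apply: H; apply/mem_set.
move=> /set_mem Ap /set_mem Aq; apply/mem_set; rewrite conv_between.
by apply: cA => //; rewrite ge0 le1.
Qed.

Lemma convex_functionP A (v : plane R -> R^o) : convex_function A v <->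
  forall p q t, A p -> A q -> 0 <= t <= 1 ->
    v (between t p q) <= t * v p + (1 - t) * v q.
Proof.
split=> [cA p q t Ap Aq /andP[t0 t1]|cA t p q /set_mem Ap /set_mem Aq].
  by have := cA (Itv01 t0 t1) p q (mem_set Ap) (mem_set Aq).
by apply: cA => //; rewrite ge0 le1.
Qed.

Lemma sub_conv_hull A : A `<=` conv_hull A.
Proof. by move=> p Ap K [_]; apply. Qed.

Lemma conv_hull_min A K : convex_set K -> A `<=` K -> conv_hull A `<=` K.
Proof. by move=> cK AK p; apply. Qed.

Lemma convex_conv_hull A : convex_set (conv_hull A).
Proof.
apply/convex_setP => p q t Hp Hq t01 K [cK AK].
by move/convex_setP: (cK); apply => //; [apply: Hp|apply: Hq].
Qed.

Lemma convex_halfplane (k l m : R) :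
  convex_set [set p : plane R | k * p.1 + l * p.2 <= m].
Proof.
apply/convex_setP => p q t /= Hp Hq /andP[t0 t1].
have /= := ler_wpM2l t0 Hp.
have t1' : 0 <= 1 - t by lra.
have := ler_wpM2l t1' Hq; lra.
Qed.

(** The points of a line given by an affine parametrization; vertical,
    horizontal and diagonal segments are instances. *)
Lemma convex_param A (c d c' d' u w x : R) : convex_set A ->
  A (c + d * u, c' + d' * u) -> A (c + d * w, c' + d' * w) ->
  u <= x <= w -> A (c + d * x, c' + d' * x).
Proof.
move=> /convex_setP cA Au Aw /andP[ux xw].
have [uw|uw] := ltP u w; last first.
  by have -> : x = w by lra.
have wu : 0 < w - u by rewrite subr_gt0.
have := cA _ _ ((w - x) / (w - u)) Au Aw.
rewrite divr_ge0 ?ler_pdivrMr //; try lra.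
have -> : between ((w - x) / (w - u)) (c + d * u, c' + d' * u)
    (c + d * w, c' + d' * w) = (c + d * x, c' + d' * x).
  by rewrite /between /=; congr (_, _); field; rewrite gt_eqF.
by apply; rewrite mul1r; lra.
Qed.

Lemma convex_vertical A (x y1 y2 y : R) : convex_set A ->
  A (x, y1) -> A (x, y2) -> y1 <= y <= y2 -> A (x, y).
Proof.
move=> cA A1 A2 y12; have := @convex_param A x 0 0 1 y1 y2 y cA.
by rewrite !mul0r !addr0 !mul1r !add0r; apply.
Qed.

Lemma convex_horizontal A (y x1 x2 x : R) : convex_set A ->
  A (x1, y) -> A (x2, y) -> x1 <= x <= x2 -> A (x, y).
Proof.
move=> cA A1 A2 x12; have := @convex_param A 0 1 y 0 x1 x2 x cA.
by rewrite !mul0r !addr0 !mul1r !add0r; apply.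
Qed.

(** The set 0 <= x <= b, max (0, m - x) <= y <= h x is the union of its vertical
    segments, whose lower ends lie on the segments from (0, m) to (m, 0) to (b, 0).
    Thus a convex set that contains these three points and the graph of [h]
    contains it. *)
Lemma convex_slab K (h : R -> R) (m b : R) (p : plane R) : convex_set K ->
  0 <= m -> K (m, 0) -> K (0, m) -> K (b, 0) ->
  (forall x, 0 <= x <= b -> K (x, h x)) ->
  0 <= p.1 <= b -> 0 <= p.2 <= h p.1 -> m <= p.1 + p.2 -> K p.
Proof.
case: p => x y /= cK m0 Km0 K0m Kb0 Kh /andP[x0 xb] /andP[y0 yh] mxy.
have Ktop : K (x, h x) by apply: Kh; rewrite x0.
have [xm|mx] := leP x m.
  have Kdiag : K (x, m - x).
    have := @convex_param K 0 1 m (-1) 0 m x cK.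
    rewrite !mul1r !add0r !mulN1r subr0 subrr x0 xm; exact.
  by apply: (convex_vertical cK Kdiag Ktop); rewrite yh andbT; lra.
apply: (@convex_vertical _ _ 0 (h x)) => //; last by rewrite y0.
by apply: (convex_horizontal cK Km0 Kb0); rewrite xb ltW.
Qed.

Lemma closed_halfplane (k l m : R) :
  closed [set p : plane R | k * p.1 + l * p.2 <= m].
Proof.
apply: (@closed_comp _ _ (fun p : plane R => k * p.1 + l * p.2) [set x : R | x <= m]).
  move=> p _; apply: cvgD; apply: cvgMr; [exact: cvg_fst|exact: cvg_snd].
exact: closed_le.
Qed.

Lemma open_halfplane (k l m : R) :
  open [set p : plane R | k * p.1 + l * p.2 < m].
Proof.
have -> : [set p : plane R | k * p.1 + l * p.2 < m] =
    ~` [set p : plane R | (- k) * p.1 + (- l) * p.2 <= - m].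
  apply/seteqP; split=> p /= => [pm|/negP]; last by rewrite -ltNge; lra.
  by apply/negP; rewrite -ltNge; lra.
exact/closed_openC/closed_halfplane.
Qed.

Lemma interior_square P p : interior P p -> exists2 e : R, 0 < e &
  forall q : plane R, `|q.1 - p.1| <= e -> `|q.2 - p.2| <= e -> P q.
Proof.
move=> /nbhs_ballP[e /= e0 He]; exists (e / 2); first by rewrite divr_gt0.
move=> q q1 q2; apply: He; split; rewrite /ball /= distrC;
  apply: le_lt_trans (_ : e / 2 < e); lra.
Qed.

End Plane.

(** * A convex function that bends at the integers *)

Section Levels.
Variables (R : realType) (n : nat).
Implicit Types (s : R) (i j k : nat).

(** The lines of slopes i and i - 1 meet at s = i. *)
Definition support_line i s : R := i%:R * s - i%:R * i.+1%:R / 2.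

Definition bend s : R := \big[Num.max/0]_(k < n) support_line k s.

Lemma support_lineB i k s :
  support_line i s - support_line k s = (i%:R - k%:R) * (s - (i%:R + k%:R + 1) / 2).
Proof. by rewrite /support_line -!natr1; field. Qed.

Lemma support_line_le_bend k s : (k < n)%N -> support_line k s <= bend s.
Proof. by move=> kn; apply: (le_bigmax _ _ (Ordinal kn)). Qed.

(** The last range is unbounded, as the slice beyond the last cut is not cut
    further. *)
Definition in_range i s : Prop := i%:R <= s /\ (s <= i.+1%:R \/ i.+1 = n).

Lemma bendE i s : (i < n)%N -> in_range i s -> bend s = support_line i s.
Proof.
move=> i_n [is_ si]; apply/eqP; rewrite eq_le support_line_le_bend // andbT.
have le0 k : (k < n)%N -> support_line k s <= support_line i s.
  move=> kn; rewrite -subr_ge0 support_lineB.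
  have [ki|ik|->] := ltngtP k i; last by rewrite subrr mul0r.
    have ki' : (k%:R + 1 : R) <= i%:R by rewrite natr1 ler_nat.
    by apply: mulr_ge0; lra.
  have ik' : (i%:R + 1 : R) <= k%:R by rewrite natr1 ler_nat.
  case: si => [|iN]; last by move: kn; rewrite -iN ltnS leqNgt ik.
  by rewrite -natr1 => si; apply: mulr_le0; lra.
apply/bigmax_leP; split=> [|k _]; last exact: le0.
have := le0 0%N; rewrite /support_line !mul0r subr0; apply.
exact: leq_ltn_trans (leq0n _) i_n.
Qed.

(** Beyond the right end of its range a support line lies strictly below. *)
Lemma bend_above i s : (i.+1 < n)%N -> i.+1%:R < s -> support_line i s < bend s.
Proof.
move=> i_n is_; apply: lt_le_trans (support_line_le_bend s i_n).
rewrite -subr_gt0 support_lineB; rewrite -(natr1 i) in is_ *.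
by apply: mulr_gt0; lra.
Qed.

Lemma range_cover s : (0 < n)%N -> 0 <= s -> exists2 i, (i < n)%N & in_range i s.
Proof.
rewrite /in_range; elim: n => // m IH _ s0; have [m0|m0] := posnP m.
  by exists 0%N => //; split=> //; right; rewrite m0.
have [sm|ms] := leP s m%:R.
  have [i im [is_ si]] := IH m0 s0; exists i; first exact: ltnW.
  by split=> //; left; case: si => // ->.
by exists m => //; split; [exact: ltW|right].
Qed.

Lemma bend_ge0 s : 0 <= bend s.
Proof. exact: bigmax_ge_id. Qed.

Lemma bend_convex s s' t : 0 <= t <= 1 ->
  bend (t * s + (1 - t) * s') <= t * bend s + (1 - t) * bend s'.
Proof.
move=> /andP[t0 t1]; have t1' : 0 <= 1 - t by lra.
apply/bigmax_leP; split=> [|k _]; first by rewrite addr_ge0 ?mulr_ge0 ?bend_ge0.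
have := ler_wpM2l t0 (support_line_le_bend s (ltn_ord k)).
have := ler_wpM2l t1' (support_line_le_bend s' (ltn_ord k)).
rewrite /support_line; lra.
Qed.

(** A bend is strict: this is why a convex set on which the function is affine
    does not cross any cut. *)
Lemma bend_strict k s s' : (0 < k < n)%N -> s < k%:R < s' ->
  exists2 t, 0 <= t <= 1 & t * s + (1 - t) * s' = k%:R /\
    bend k%:R < t * bend s + (1 - t) * bend s'.
Proof.
case: k => // k /= kn /andP[sk ks]; pose t : R := (s' - k.+1%:R) / (s' - s).
have ss : 0 < s' - s by lra.
have tE : t * (s' - s) = s' - k.+1%:R by rewrite /t mulfVK // gt_eqF.
have t0 : 0 <= t by rewrite divr_ge0 //; lra.
have t1 : t < 1 by rewrite ltr_pdivrMr //; lra.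
clearbody t; exists t; first by rewrite t0 ltW.
have stE : t * s + (1 - t) * s' = k.+1%:R by lra.
split=> //; have -> : bend k.+1%:R = support_line k k.+1%:R.
  apply: bendE; first exact: ltnW.
  by split; [rewrite ler_nat|left].
have := ler_wpM2l t0 (support_line_le_bend s (ltnW kn)).
have t1' : 0 < 1 - t by lra.
have := ltr_pM2l t1' (support_line k s') (bend s').
rewrite (bend_above kn ks) => lt2 le1.
apply: lt_le_trans (_ : t * support_line k s + (1 - t) * bend s' <= _); last lra.
apply: le_lt_trans (_ : _ <= t * support_line k s + (1 - t) * support_line k s') _.
  by rewrite -{1}stE /support_line; lra.
by rewrite ltrD2l lt2.
Qed.

End Levels.

(** * Slices of a polygon *)

Section Slices.
Variables (R : realType) (n : nat) (P : set (plane R)) (a : R).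
Implicit Types (p q : plane R) (i j k : nat) (A : set (plane R)).

Definition slice i : set (plane R) :=
  [set p | P p /\ in_range n i (p.1 + p.2)].

Definition slices (i : 'I_n) : set (plane R) := slice i.

Definition diagonal_bend : plane R -> R^o := fun p => bend n (p.1 + p.2).

Hypotheses (n_gt0 : (0 < n)%N) (convexP : convex_set P) (closedP : closed P).
Hypothesis quadrant : forall p, P p -> 0 <= p.1 /\ 0 <= p.2.
Hypotheses (a_ge1 : 1 <= a) (na : n.-1%:R <= a).
Hypothesis corner : forall x y : R, 0 <= x -> 0 <= y -> x + y <= a -> P (x, y).
Hypothesis tip : exists2 p, P p & n.-1%:R < p.1 + p.2.
Hypothesis polygon_last : lattice_polygon (slice n.-1).

Lemma convex_slice i : convex_set (slice i).
Proof.
apply/convex_setP => p q t [Pp [p1 p2]] [Pq [q1 q2]] t01; split.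
  by move/convex_setP: convexP; apply.
move: t01 => /andP[t0 t1]; have t1' : 0 <= 1 - t by lra.
split=> /=; first by have := ler_wpM2l t0 p1; have := ler_wpM2l t1' q1; lra.
case: p2 => [p2|]; last by right.
case: q2 => [q2|]; last by right.
by left; have := ler_wpM2l t0 p2; have := ler_wpM2l t1' q2; lra.
Qed.

Lemma closed_slice i : closed (slice i).
Proof.
have -> : slice i = P `&` ([set p : plane R | (-1) * p.1 + (-1) * p.2 <= - i%:R] `&`
    ([set p : plane R | 1 * p.1 + 1 * p.2 <= i.+1%:R] `|`
     if i.+1 == n then setT else set0)).
  apply/seteqP; split=> p /=.
    move=> [Pp [p1 p2]]; split=> //; split; first by lra.
    by case: p2 => [p2| ->]; [left; lra|right; rewrite eqxx].
  move=> [Pp [p1 p2]]; split=> //; split; first by lra.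
  by case: p2 => [p2|]; [left; lra|case: eqP => // e _; right].
do 2![apply: closedI => //]; first exact: closed_halfplane.
apply: closedU; first exact: closed_halfplane.
by case: eqP => _; [exact: closedT|exact: closed0].
Qed.

Lemma diagonal_bendE i p : (i < n)%N -> slice i p ->
  diagonal_bend p = i%:R * p.1 + i%:R * p.2 - i%:R * i.+1%:R / 2.
Proof.
by move=> i_n [_ pi]; rewrite /diagonal_bend (bendE i_n pi) /support_line mulrDr.
Qed.

Lemma slice_corner i (x y : R) : 0 <= x -> 0 <= y -> x + y <= a ->
  i%:R <= x + y <= i.+1%:R -> slice i (x, y).
Proof.
move=> x0 y0 xyn /andP[ixy xyi]; split; first exact: corner.
by split=> //; left.
Qed.

Lemma le_a i : (i < n)%N -> i%:R <= a.
Proof. by move=> i_n; apply: le_trans na; rewrite ler_nat; lia. Qed.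

Lemma slice_low i : (i < n)%N -> slice i (i%:R, 0) /\ slice i (0, i%:R).
Proof.
move=> i_n; have ia := le_a i_n.
by split; apply: slice_corner; rewrite ?addr0 ?add0r ?lexx ?ler0n //= ler_nat.
Qed.

Lemma slice_high i : (i < n)%N -> exists2 p, slice i p & i%:R < p.1 + p.2.
Proof.
move=> i_n; have [i1n|ni] := ltnP i.+1 n.
  exists (i.+1%:R, 0); last by rewrite /= addr0 ltr_nat.
  by apply: slice_corner; rewrite ?addr0 ?(le_a i1n) // ler_nat leqnSn /=.
have iE : i.+1 = n by apply/eqP; rewrite eqn_leq i_n.
have [p Pp tp] := tip; have iE' : n.-1 = i by rewrite -iE.
rewrite iE' in tp; exists p => //.
by split=> //; split; [exact: ltW|right].
Qed.

(** The points (i, 0) and (0, i) of the lower cut and a point beyond it are not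
    collinear for i > 0; the first slice contains (0, 0), (1, 0) and (0, 1). *)
Lemma two_dimensional_slice i : (i < n)%N -> two_dimensional (slice i).
Proof.
move=> i_n k l m H; have [lo1 lo2] := slice_low i_n.
have [p pi ip] := slice_high i_n.
have := H _ lo1; have := H _ lo2; have := H _ pi.
rewrite /= !mulr0 add0r addr0 => Hp Hl Hk.
have [i0|i0] := posnP i.
  have m0 : m = 0 by rewrite -Hl i0 mulr0.
  have sx : slice i (1, 0).
    by apply: slice_corner; rewrite ?i0 ?addr0 ?ler01 ?lexx //=.
  have sy : slice i (0, 1).
    by apply: slice_corner; rewrite ?i0 ?add0r ?ler01 ?lexx //=.
  by have := H _ sx; have := H _ sy; rewrite /= m0 !mulr0 !mulr1 addr0 add0r.
have iR : i%:R != 0 :> R by rewrite pnatr_eq0 -lt0n.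
have kl : k = l by apply: (mulIf iR); rewrite Hl Hk.
have k0 : k = 0.
  have : k * (p.1 + p.2 - i%:R) = 0 by rewrite -kl in Hp; lra.
  by move/eqP; rewrite mulf_eq0 subr_eq0 (gt_eqF ip) orbF => /eqP.
by rewrite -kl k0.
Qed.

Lemma slice_sub_eq i j : (i < n)%N -> (j < n)%N -> slice i `<=` slice j -> i = j.
Proof.
move=> i_n j_n sub; have [[_ [ji _]] _] := (sub _ (slice_low i_n).1, tt).
have [p /sub[_ [_ pj]] ip] := slice_high i_n.
rewrite /= addr0 ler_nat in ji.
apply/eqP; rewrite eqn_leq ji andbT leqNgt; apply/negP => {}ji.
case: pj => [pj|jn]; last by rewrite -jn ltnS leqNgt ji in i_n.
have : (j.+1%:R : R) <= i%:R by rewrite ler_nat.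
lra.
Qed.

Lemma linear_piece_slice i : (i < n)%N -> linear_piece P diagonal_bend (slice i).
Proof.
move=> i_n; split; [by move=> p []|exact: closed_slice|exact: convex_slice|].
exists i%:R, i%:R, (- (i%:R * i.+1%:R / 2)) => p; exact: diagonal_bendE.
Qed.

(** By strictness of the bends a convex set on which the function is affine cannot
    have points on both sides of a cut.  It lies in the slice that starts at the
    highest level below one of its points. *)
Lemma linear_piece_sub A : linear_piece P diagonal_bend A ->
  exists2 i, (i < n)%N & A `<=` slice i.
Proof.
move=> [AP _ cA [k [l [m vA]]]].
have split_ i p q : (0 < i < n)%N -> A p -> A q ->
    p.1 + p.2 < i%:R < q.1 + q.2 -> False.
  move=> i_n Ap Aq /(bend_strict i_n)[t t01 [pq]]; apply/negP; rewrite -leNgt.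
  move/convex_setP: cA => /(_ _ _ _ Ap Aq t01)/vA; rewrite /diagonal_bend /=.
  have -> : t * p.1 + (1 - t) * q.1 + (t * p.2 + (1 - t) * q.2) = i%:R by lra.
  move=> ->; have := vA _ Ap; have := vA _ Aq; rewrite /diagonal_bend => -> ->.
  by rewrite le_eqVlt; apply/orP; left; apply/eqP; ring.
(* The levels that have points of A beyond them. *)
pose low i := (i < n)%N && `[< exists2 q, A q & i%:R < q.1 + q.2 >].
have [ex|nex] := pselect (exists i, low i); last first.
  exists 0%N => // p Ap; split; first exact: AP.
  have [p1 p2] := quadrant (AP _ Ap); split; first by rewrite addr_ge0.
  left; rewrite leNgt; apply/negP => p0; apply: nex; exists 0%N.
  by rewrite /low n_gt0; apply/asboolP; exists p => //; apply: lt_trans p0.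
have lown i : low i -> (i <= n)%N by move=> /andP[/ltnW].
case: (ex_maxnP ex lown) => i /andP[i_n /asboolP[q Aq iq]] maxi.
exists i => // p Ap; split; first exact: AP.
split.
  have [i0|i0] := posnP i.
    by rewrite i0; have [p1 p2] := quadrant (AP _ Ap); rewrite addr_ge0.
  rewrite leNgt; apply/negP => pi; apply: (@split_ i p q) => //; first by rewrite i0.
  by rewrite pi.
have [i1n|] := ltnP i.+1 n; last by right; apply/eqP; rewrite eqn_leq i_n.
left; rewrite leNgt; apply/negP => ip; have := maxi i.+1.
rewrite /low i1n /= ltnn => H; apply/notF/H/asboolP.
by exists p.
Qed.

Lemma realizes_slices : realizes P diagonal_bend slices.
Proof.
split.
- apply/convex_functionP => p q t Pp Pq t01; rewrite /diagonal_bend /=.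
  have := bend_convex n (p.1 + p.2) (q.1 + q.2) t01; apply: le_trans.
  by rewrite le_eqVlt; apply/orP; left; apply/eqP; congr bend; ring.
- exists n, slices; split=> [i|].
    by have [_] := linear_piece_slice (ltn_ord i).
  apply/seteqP; split=> [p Pp|p [i _ []//]].
  have [p1 p2] := quadrant Pp.
  have [i i_n pi] := range_cover n_gt0 (addr_ge0 p1 p2).
  by exists (Ordinal i_n).
move=> A; split=> [[lA maxA]|[i ->]].
  have [i i_n Ai] := linear_piece_sub lA; exists (Ordinal i_n).
  by apply: maxA => //; apply: linear_piece_slice.
split=> [|B lB iB]; first exact: linear_piece_slice.
have [j j_n Bj] := linear_piece_sub lB.
have ij : nat_of_ord i = j by apply: slice_sub_eq => //; apply: subset_trans Bj.
by apply/seteqP; split=> //; rewrite /slices ij.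
Qed.

(** Below the last cut a slice is the trapezoid between two cuts, which
    [convex_slab] describes with the upper cut as graph. *)
Lemma lattice_polygon_slice i : (i < n)%N -> lattice_polygon (slice i).
Proof.
move=> i_n; have [i1n|ni] := ltnP i.+1 n; last first.
  by have -> : i = n.-1 by lia.
have ia := le_a i_n; have i1a := le_a i1n.
have nonneg j : 0 <= (j%:R : R) by rewrite ler0n.
have int_nat j : (j%:R : R) \is a Num.int by rewrite natr_int.
exists [set` [:: (i%:R, 0); (0, i%:R); (i.+1%:R, 0); (0, i.+1%:R)] : seq (plane R)].
split; first exact: finite_seq.
  move=> p; rewrite /= !inE => /or4P[]/eqP ->; split=> //=; exact: int_num0.
apply/seteqP; split; last first.
  apply: conv_hull_min; first exact: convex_slice.
  by move=> p; rewrite /= !inE => /or4P[]/eqP ->; apply: slice_corner;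
    rewrite ?addr0 ?add0r ?lexx ?ler_nat ?leqnSn.
set K := conv_hull _; have cK : convex_set K by apply: convex_conv_hull.
have K1 : K (i%:R, 0) by apply: sub_conv_hull; rewrite /= !inE eqxx.
have K2 : K (0, i%:R) by apply: sub_conv_hull; rewrite /= !inE eqxx orbT.
have K3 : K (i.+1%:R, 0) by apply: sub_conv_hull; rewrite /= !inE eqxx !orbT.
have K4 : K (0, i.+1%:R) by apply: sub_conv_hull; rewrite /= !inE eqxx !orbT.
move=> p [Pp [p1 p2]]; have [p10 p20] := quadrant Pp.
case: p2 => [p2|iN]; last by rewrite iN ltnn in i1n.
apply: (convex_slab (h := fun x => i.+1%:R - x) cK _ K1 K2 K3) => //.
- move=> x x01; have := @convex_param R K 0 1 i.+1%:R (-1) 0 i.+1%:R x cK.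
  rewrite !mul1r !add0r !mulN1r subr0 subrr; exact.
- by rewrite p10; lra.
- by rewrite p20; lra.
Qed.

Lemma regular_slices : regular_subdivision P slices.
Proof.
split.
- move=> i j ij; apply: val_inj; apply: (@slice_sub_eq i j) => //.
  by move: ij; rewrite /slices => ->.
- by move=> i; split; [apply: lattice_polygon_slice|apply: two_dimensional_slice].
by exists diagonal_bend; apply: realizes_slices.
Qed.

(** The constants i (i + 1) / 2 are binomial coefficients. *)
Lemma diagonal_bend_int p : P p -> lattice p -> diagonal_bend p \is a Num.int.
Proof.
move=> Pp [p1 p2]; have [p10 p20] := quadrant Pp.
have [i i_n pi] := range_cover n_gt0 (addr_ge0 p10 p20).
rewrite (diagonal_bendE i_n) //.
have -> : (i%:R * i.+1%:R / 2 : R) = 'C(i.+1, 2)%:R.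
  apply: (mulIf (_ : 2 != 0 :> R)); first by rewrite pnatr_eq0.
  rewrite divfK ?pnatr_eq0 // -!natrM; congr _%:R.
  by rewrite [RHS]mulnC -(mul_bin_diag i.+1 1) bin1 mulnC.
by rewrite rpredB ?rpredD ?rpredM ?natr_int.
Qed.

Lemma normal_slice i : (i < n)%N -> normal diagonal_bend (slice i) = (- i%:Z, - i%:Z).
Proof.
move=> i_n; have iE : (- i%:Z)%:~R = - i%:R :> R by rewrite mulrNz -pmulrn.
apply: xget_unique => [|[k l]].
  exists (- (i%:R * i.+1%:R / 2)) => p /(diagonal_bendE i_n) -> /=.
  by rewrite iE; ring.
move=> [c /= H]; have [|k0 l0] := two_dimensional_slice i_n
  (k := k%:~R + i%:R) (l := l%:~R + i%:R) (m := c + i%:R * i.+1%:R / 2).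
  by move=> p pi; have := H p pi; rewrite (diagonal_bendE i_n pi); lra.
by congr (_, _); apply: (@intr_inj R); rewrite iE; lra.
Qed.

(** Consecutive slices meet in a cut, which contains the lattice points
    (j, l + 1 - j); slices further apart are disjoint. *)
Lemma int_length_slices (l m : 'I_n) : (l < m)%N ->
  int_length slices l m = if m == l.+1 :> nat then l.+1 else 0%N.
Proof.
move=> lm; rewrite /int_length; set S := _ `&` @lattice R.
have [ml|ml] := eqVneq; last first.
  have -> : S = set0; last by rewrite fset_set0 cardfs0.
  apply/seteqP; split=> // p [[[_ [_ pl]] [_ [pm _]]] _].
  case: pl => [pl|ln]; last by have := ltn_ord m; lia.
  have : (m%:R : R) <= l.+1%:R by lra.
  rewrite ler_nat; lia.
pose g (j : nat) : plane R := (j%:R, l.+1%:R - j%:R).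
have l1a : l.+1%:R <= a by apply: le_a; rewrite -ml.
have -> : S = g @` `I_l.+2.
  apply/seteqP; split=> [[x y]|_ [j /= jl2 <-]].
    move=> [[[Pxy [_ pl]] [_ [pm _]]] [/= xint yint]].
    have [/= x0 y0] := quadrant Pxy.
    rewrite /= ml in pm.
    case: pl => [/= pl|ln]; last by have := ltn_ord m; lia.
    have /natrP[j xj] : x \is a Num.nat by rewrite natrEint xint.
    have jl : (j < l.+2)%N.
      have : (j%:R : R) <= l.+1%:R by rewrite -xj; lra.
      by rewrite ler_nat.
    by exists j => //; rewrite /g -xj; congr (_, _); lra.
  have jl : (j%:R : R) <= l.+1%:R by rewrite ler_nat -ltnS.
  have ge1 : 0 <= (j%:R : R) by rewrite ler0n.
  have sumE : (j%:R : R) + (l.+1%:R - j%:R) = l.+1%:R by lra.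
  split; last by split; rewrite /= ?rpredB ?natr_int.
  have sl k : k%:R <= (l.+1%:R : R) <= k.+1%:R -> slice k (g j).
    by move=> kl; rewrite /g; apply: slice_corner; rewrite ?sumE ?subr_ge0 //.
  by split; [apply: sl; rewrite !ler_nat leqnSn leqnn|
             apply: sl; rewrite ml !ler_nat leqnSn leqnn].
have inj_g : injective g by move=> j j' [/eqP]; rewrite eqr_nat => /eqP.
rewrite (@card_fset_set _ _ l.+2) //.
by apply: inj_card_eq => j j' _ _; exact: inj_g.
Qed.

End Slices.

(** * The metric graph of the slices *)

Section ChainGraph.
Variables (R : realType) (N : nat) (D : 'I_N.+1 -> set (plane R)) (v : plane R -> R^o).
Hypothesis lengthD : forall l m : 'I_N.+1, (l < m)%N ->
  int_length D l m = if m == l.+1 :> nat then l.+1 else 0%N.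
Hypothesis normalD : forall i : 'I_N.+1, normal v (D i) = (- i%:Z, - i%:Z).

Let G := weighted_graph D v.
Let d (e : dual_edge D) : nat :=
  minors_gcd (normal v (D (tag e).1)) (normal v (D (tag e).2)).

Lemma dual_edge_next (e : dual_edge D) : (tag e).2 = (tag e).1.+1 :> nat.
Proof.
case: e => [[l m] [j /= jlm]]; move: jlm; rewrite /num_edges /=.
by case: ifP => // lm; rewrite lengthD //; case: eqP.
Qed.

(** The normals (-l, -l) and (-l-1, -l-1) differ by (1, 1), so two of the three
    minors are 1. *)
Lemma dual_edge_weight e : d e = 1%N.
Proof.
rewrite /d !normalD dual_edge_next /minors_gcd /=.
have -> : - (tag e).1%:Z * - (tag e).1.+1%:Z - - (tag e).1%:Z * - (tag e).1.+1%:Z = 0.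
  by rewrite subrr.
have -> : - (tag e).1%:Z * 1 - 1 * - (tag e).1.+1%:Z = 1 by lia.
by [].
Qed.

(** As no edge is subdivided, the slices are the only vertices. *)
Definition chain_pos (x : vertex G) : 'I_N.+1 :=
  if x is inl i then i else ord0.

Let edge_index (x : edge G) : 'I_N.+1 := (tag (tag x)).1.

Lemma chain_source (x : edge G) : source x = inl (edge_index x) :> vertex G.
Proof.
case: x => e [k kd]; have k0 : k = 0%N.
  by move: (kd); rewrite -/(d e) dual_edge_weight; case: (k).
by move: kd; rewrite k0.
Qed.

Lemma chain_target (x : edge G) : target x = inl (tag (tag x)).2 :> vertex G.
Proof.
case: x => e [k kd]; have k0 : k = 0%N.
  by move: (kd); rewrite -/(d e) dual_edge_weight; case: (k).
move: kd; rewrite k0 => kd; rewrite /= /path_vertex /= insubN //.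
by rewrite -/(d e) dual_edge_weight.
Qed.

Lemma staircase_chain : staircase chain_pos.
Proof.
split.
- exists inl => // -[i //|[e [k kd]]]; exfalso.
  by move: kd; rewrite -/(d e) dual_edge_weight.
- by move=> x; rewrite chain_source chain_target /= dual_edge_next.
move=> k kN; rewrite -sum1_card.
rewrite (eq_bigl (fun x : edge G => (edge_index x == k :> nat) && true)); last first.
  move=> x; transitivity (chain_pos (source x) == k :> nat) => //.
  by rewrite chain_source andbT.
rewrite -(@sig_big_dep _ 0%N addn (dual_edge D) (fun e => 'I_(d e))
  (fun e => (tag e).1 == k :> nat) (fun _ _ => true) (fun _ _ => 1%N)).
under eq_bigr => e _ do rewrite sum1_card card_ord dual_edge_weight.
rewrite (eq_bigl (fun e : dual_edge D => ((tag e).1 == k :> nat) && true)); last first.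
  by move=> e; rewrite andbT.
rewrite -(@sig_big_dep _ 0%N addn _ (fun lm => 'I_(num_edges D lm))
  (fun lm => lm.1 == k :> nat) (fun _ _ => true) (fun _ _ => 1%N)).
under eq_bigr => lm _ do rewrite sum1_card card_ord.
have kN1 : (k < N.+1)%N by rewrite ltnW.
have kN2 : (k.+1 < N.+1)%N by [].
rewrite (bigD1 (Ordinal kN1, Ordinal kN2)) /=; last by [].
rewrite big1 ?addn0 => [|[l m] /= /andP[/eqP lk nlm]].
  by rewrite /num_edges /= ltnSn lengthD //= eqxx.
rewrite /num_edges /=; case: ifP => // lm; rewrite lengthD //.
by case: eqP => // ml; move: nlm; rewrite xpair_eqE -!val_eqE /= ml lk !eqxx.
Qed.

End ChainGraph.

(** * Lattice width and the triangle 2 Upsilon *)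

Section LatticeWidth.
Variables (R : realType) (P : set (plane R)).

Lemma width_no_interior_point :
  (forall p, interior P p -> ~ lattice p) -> is_lattice_width (interior_hull P) (-1).
Proof.
move=> noP; left; split=> //; apply/seteqP; split=> //.
apply: conv_hull_min; last by move=> p [/noP].
by apply/convex_setP => p q t [].
Qed.

Lemma det2 (M : 'M[int]_2) : \det M = M 0 0 * M 1 1 - M 0 1 * M 1 0.
Proof.
rewrite (expand_det_row M ord0) !big_ord_recl big_ord0 addr0 /cofactor /=.
rewrite !det_mx11 !mxE /=.
have -> : fintype.lift ord0 ord0 = 1 :> 'I_2 by apply: val_inj.
have -> : fintype.lift 1 ord0 = 0 :> 'I_2 by apply: val_inj.
rewrite expr0 expr1 mul1r; ring.
Qed.

(** A nonzero integral linear form takes values at least [w] apart at two of the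
    three given points, and the form y stays within the strip. *)
Lemma width_interior_triangle (w : nat) :
  interior P (1, 1) -> interior P (1, 1 + w%:R) -> interior P (1 + w%:R, 1) ->
  (forall p, interior P p -> lattice p -> 1 <= p.2 <= 1 + w%:R) ->
  is_lattice_width (interior_hull P) w.
Proof.
move=> P1 P2 P3 strip; right.
have lat1 : (1 : R) \is a Num.int by rewrite int_num1.
have latw : (1 + w%:R : R) \is a Num.int by rewrite rpredD ?natr_int.
have Q1 : interior_hull P (1, 1) by apply: sub_conv_hull.
have Q2 : interior_hull P (1, 1 + w%:R) by apply: sub_conv_hull.
have Q3 : interior_hull P (1 + w%:R, 1) by apply: sub_conv_hull.
split=> //; first by exists (1, 1).
- exists (fun p => (p.1, p.2 - 1)); split.
    exists 1%:M, (0, -1); split=> [|p]; first by rewrite unitmx1.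
    by rewrite !mxE /=; congr (_, _); ring.
  move=> _ [p Qp <-] /=.
  have /= lo : [set q : plane R | 0 * q.1 + (-1) * q.2 <= -1] p.
    apply: Qp; split; first exact: convex_halfplane.
    by move=> q [/strip H /H /andP[]] /=; lra.
  have /= hi : [set q : plane R | 0 * q.1 + 1 * q.2 <= 1 + w%:R] p.
    apply: Qp; split; first exact: convex_halfplane.
    by move=> q [/strip H /H /andP[]] /=; lra.
  by rewrite -pmulrn; apply/andP; split; lra.
move=> s s0 [phi [[M [t [uM phiE]]] sub]].
have h p : interior_hull P p -> 0 <= (phi p).2 <= (s%:~R : R).
  by move=> Qp; apply: sub; exists p.
have := h _ Q1; have := h _ Q2; have := h _ Q3; rewrite !phiE /= !mulr1 {h}.
move=> /andP[a1 a2] /andP[b1 b2] /andP[c1 c2].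
have bound (k : int) : k != 0 -> `|k%:~R * w%:R| <= (s%:~R : R) -> w%:Z <= s.
  move=> k0; rewrite normrM -intr_norm => ks.
  rewrite -(ler_int R) -pmulrn; apply: le_trans ks; rewrite normr_nat.
  by rewrite ler_peMl ?ler0n // (ler1z R) -gtz0_ge1 normr_gt0.
have [k0|k0] := eqVneq (M 1 0) 0; last first.
  by apply: (bound _ k0); rewrite ler_norml; apply/andP; split; lra.
apply: (bound (M 1 1)); last by rewrite ler_norml; apply/andP; split; lra.
apply: contraTneq uM => l0; rewrite unitmxE det2 k0 l0 !mulr0 subrr.
by rewrite unitr0.
Qed.

End LatticeWidth.

Section TwoUpsilon.
Variable R : realType.
Implicit Types (p q : plane R).

Lemma twoUpsilon_edges p : @twoUpsilon R p ->
  [/\ p.1 + p.2 <= 2, p.2 - 2 * p.1 <= 2 & p.1 - 2 * p.2 <= 2].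
Proof.
have vertex_bound (k l m : R) : k * -1 + l * -1 <= m -> k * 1 + l * 0 <= m ->
    k * 0 + l * 1 <= m -> forall q, @Upsilon R q -> k * q.1 + l * q.2 <= m.
  move=> h1 h2 h3; apply: (@conv_hull_min _ _ [set q | k * q.1 + l * q.2 <= m]).
    exact: convex_halfplane.
  by move=> r /=; rewrite !inE => /or3P[]/eqP ->.
move=> [q Uq <-]; split; rewrite /= /GRing.scale /=.
- by have := vertex_bound 1 1 1 _ _ _ q Uq; lra.
- by have := vertex_bound (-2) 1 1 _ _ _ q Uq; lra.
by have := vertex_bound 1 (-2) 1 _ _ _ q Uq; lra.
Qed.

Lemma twoUpsilon_vertices :
  [/\ @twoUpsilon R (-2, -2), @twoUpsilon R (2, 0) & @twoUpsilon R (0, 2)].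
Proof.
split; [exists (-1, -1)|exists (1, 0)|exists (0, 1)];
  try (by apply: sub_conv_hull; rewrite /= !inE eqxx ?orbT);
  by congr (_, _); rewrite /= /GRing.scale /=; lra.
Qed.

(** A form that is nonnegative on the triangle and vanishes at two of its points
    vanishes at two of its vertices, so it is a multiple of the normal of an edge;
    these normals are (1, 1), (-2, 1), (1, -2). *)
Lemma twoUpsilon_edge_functional (k l : int) (c : R) p q :
  let h (r : plane R) := k%:~R * r.1 + l%:~R * r.2 + c in
  (forall r, @twoUpsilon R r -> 0 <= h r) -> @twoUpsilon R p -> @twoUpsilon R q ->
  h p = 0 -> h q = 0 -> p <> q -> exists z, k - l = 3 * z.
Proof.
move=> h h_ge0 Up Uq hp hq pq.
have [U0 U1 U2] := twoUpsilon_vertices.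
have n0 := h_ge0 _ U0; have n1 := h_ge0 _ U1; have n2 := h_ge0 _ U2.
(* The factors are six times the barycentric coordinates of r, and h r is the
   mean of the values at the vertices with these weights. *)
have bary r : @twoUpsilon R r -> h r = 0 ->
    [/\ (2 - r.1 - r.2) * h (-2, -2) = 0, (2 + 2 * r.1 - r.2) * h (2, 0) = 0 &
        (2 - r.1 + 2 * r.2) * h (0, 2) = 0].
  move=> /twoUpsilon_edges[r0 r1 r2] hr.
  have s0 : 0 <= (2 - r.1 - r.2) * h (-2, -2) by apply: mulr_ge0 => //; lra.
  have s1 : 0 <= (2 + 2 * r.1 - r.2) * h (2, 0) by apply: mulr_ge0 => //; lra.
  have s2 : 0 <= (2 - r.1 + 2 * r.2) * h (0, 2) by apply: mulr_ge0 => //; lra.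
  have sum0 : (2 - r.1 - r.2) * h (-2, -2) + (2 + 2 * r.1 - r.2) * h (2, 0) +
      (2 - r.1 + 2 * r.2) * h (0, 2) = 0.
    transitivity (6 * h r); last by rewrite hr mulr0.
    by rewrite /h /=; ring.
  by split; lra.
have [p0 p1 p2] := bary _ Up hp; have [q0 q1 q2] := bary _ Uq hq.
have cancel (x y : R) : 0 < y -> x * y = 0 -> x = 0.
  by move=> y0 /eqP; rewrite mulf_eq0 (gt_eqF y0) orbF => /eqP.
have same : p.1 = q.1 -> p.2 = q.2 -> False.
  by move=> h1 h2; apply: pq; case: (p) (q) h1 h2 => ? ? [? ?] /= -> ->.
(* If the form is positive at two vertices, then it vanishes at most at the
   third one. *)
have [e1|g1] := eqVneq (h (2, 0)) 0; have [e2|g2] := eqVneq (h (0, 2)) 0.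
- exists 0; apply: (@intr_inj R); rewrite mulr0 intrB; move: e1 e2; rewrite /h /=; lra.
- have [e0|g0] := eqVneq (h (-2, -2)) 0.
    by exists k; apply: (@intr_inj R); rewrite intrB intrM;
      move: e0 e1; rewrite /h /=; lra.
  have {}g0 : 0 < h (-2, -2) by rewrite lt_def g0.
  have {}g2 : 0 < h (0, 2) by rewrite lt_def g2.
  have := cancel _ _ g0 p0; have := cancel _ _ g0 q0.
  have := cancel _ _ g2 p2; have := cancel _ _ g2 q2.
  by move=> *; exfalso; apply: same; lra.
- have [e0|g0] := eqVneq (h (-2, -2)) 0.
    by exists (- l); apply: (@intr_inj R); rewrite intrB intrM mulrNz;
      move: e0 e2; rewrite /h /=; lra.
  have {}g0 : 0 < h (-2, -2) by rewrite lt_def g0.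
  have {}g1 : 0 < h (2, 0) by rewrite lt_def g1.
  have := cancel _ _ g0 p0; have := cancel _ _ g0 q0.
  have := cancel _ _ g1 p1; have := cancel _ _ g1 q1.
  by move=> *; exfalso; apply: same; lra.
have {}g1 : 0 < h (2, 0) by rewrite lt_def g1.
have {}g2 : 0 < h (0, 2) by rewrite lt_def g2.
have := cancel _ _ g1 p1; have := cancel _ _ g1 q1.
have := cancel _ _ g2 p2; have := cancel _ _ g2 q2.
by move=> *; exfalso; apply: same; lra.
Qed.

(** The two coordinates are nonnegative on [P] and vanish at two of its points.
    Carried over to 2 Upsilon they are forms k x + l y + c with k = l modulo 3, and
    the determinant of two such forms is divisible by 3, hence not a unit. *)
Lemma quadrant_not_twoUpsilon (P : set (plane R)) (a b : R) :
  0 < a -> 0 < b -> P (0, 0) -> P (b, 0) -> P (0, a) ->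
  (forall p, P p -> 0 <= p.1 /\ 0 <= p.2) -> ~ Zequivalent P (@twoUpsilon R).
Proof.
move=> a0 b0 P00 Pb0 P0a quad [phi [[M [t [uM phiE]]] imP]].
pose d := \det M; have dd : d * d = 1.
  by rewrite unitmxE in uM; exact: (mulVr uM).
have U p : P p -> @twoUpsilon R (phi p) by move=> Pp; rewrite -imP; exists p.
have ddR : (d%:~R * d%:~R : R) = 1 by rewrite -intrM dd.
have dE : (d%:~R : R) = (M 0 0)%:~R * (M 1 1)%:~R - (M 0 1)%:~R * (M 1 0)%:~R.
  by rewrite /d det2 intrB !intrM.
pose t1 : R := t.1%:~R; pose t2 : R := t.2%:~R.
have xE p : (d * M 1 1)%:~R * (phi p).1 + (- (d * M 0 1))%:~R * (phi p).2
    + (d%:~R * ((M 0 1)%:~R * t2 - (M 1 1)%:~R * t1)) = p.1.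
  rewrite phiE /= -/t1 -/t2 mulrNz !intrM.
  transitivity (d%:~R * ((M 0 0)%:~R * (M 1 1)%:~R - (M 0 1)%:~R * (M 1 0)%:~R) * p.1).
    by ring.
  by rewrite -dE ddR mul1r.
have yE p : (- (d * M 1 0))%:~R * (phi p).1 + (d * M 0 0)%:~R * (phi p).2
    + (d%:~R * ((M 1 0)%:~R * t1 - (M 0 0)%:~R * t2)) = p.2.
  rewrite phiE /= -/t1 -/t2 mulrNz !intrM.
  transitivity (d%:~R * ((M 0 0)%:~R * (M 1 1)%:~R - (M 0 1)%:~R * (M 1 0)%:~R) * p.2).
    by ring.
  by rewrite -dE ddR mul1r.
have [] := twoUpsilon_edge_functional _ (U _ P00) (U _ P0a) (xE (0, 0)) (xE (0, a)).
- by move=> r; rewrite -imP => -[p /quad[p1 _] <-]; rewrite xE.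
- by move=> e; have := yE (0, 0); rewrite e yE /=; lra.
move=> z1 z1E.
have [] := twoUpsilon_edge_functional _ (U _ P00) (U _ Pb0) (yE (0, 0)) (yE (b, 0)).
- by move=> r; rewrite -imP => -[p /quad[_ p2] <-]; rewrite yE.
- by move=> e; have := xE (0, 0); rewrite e xE /=; lra.
move=> z2 z2E.
have dI : d = M 0 0 * M 1 1 - M 0 1 * M 1 0 by rewrite /d det2.
have m01 : M 0 1 = d * (3 * z1) - M 1 1.
  by rewrite -z1E opprK mulrDr !mulrA dd !mul1r addrC addKr.
have m10 : M 1 0 = - (d * (3 * z2)) - M 0 0.
  by rewrite -z2E mulrBr mulrN !mulrA dd !mul1r; ring.
(* Modulo 3 the columns of M are multiples of (1, -1), so d vanishes modulo 3. *)
have d3 : d = 3 * (3 * z1 * z2 + d * z1 * M 0 0 - d * z2 * M 1 1).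
  transitivity (M 0 0 * M 1 1 - M 0 1 * M 1 0) => //.
  transitivity (9 * (d * d) * z1 * z2 + 3 * d * z1 * M 0 0 - 3 * d * z2 * M 1 1).
    by rewrite m01 m10; ring.
  by rewrite dd; ring.
move: (3 * z1 * z2 + _ - _) d3 => w dw; rewrite dw in dd.
have : 9 * (w * w) = 1 :> int by rewrite -[RHS]dd; ring.
by move: (w * w) => u; lia.
Qed.

End TwoUpsilon.

(** * The polygon under the graph of f *)

Section Region.
Variables (R : realType) (a b : int) (f : R^o -> R^o).
Hypothesis hab : 1 <= a <= b.
Hypothesis f_concave : forall x y t : R, 0 <= x <= b%:~R -> 0 <= y <= b%:~R ->
  0 <= t <= 1 -> t * f x + (1 - t) * f y <= f (t * x + (1 - t) * y).
Hypothesis f_pl : lattice_piecewise_linear b f.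
Hypothesis f_ge0 : forall x : R, 0 <= x <= b%:~R -> 0 <= f x.
Hypotheses (f0 : f 0 = a%:~R) (f1 : f 1 <= a%:~R) (fb : f b%:~R = 0).

Let A : R := a%:~R.
Let B : R := b%:~R.

Definition subgraph : set (plane R) :=
  [set p | 0 <= p.1 <= (b%:~R : R) /\ 0 <= p.2 <= f p.1].

Lemma bounds : 1 <= A /\ A <= B.
Proof. by rewrite (ler1z R) ler_int; apply/andP. Qed.

Lemma convex_subgraph : convex_set subgraph.
Proof.
apply/convex_setP => -[x y] [x' y'] t [/= xb yf] [/= xb' yf'] t01.
have := f_concave xb xb' t01; rewrite /subgraph /=.
move: t01 xb yf xb' yf' => /andP[t0 t1] /andP[x0 xb] /andP[y0 yf] /andP[x'0 xb']
  /andP[y'0 yf'] fc; have t1' : 0 <= 1 - t by lra.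
have := ler_wpM2l t0 xb; have := ler_wpM2l t1' xb'.
have := ler_wpM2l t0 yf; have := ler_wpM2l t1' yf'.
have := mulr_ge0 t0 x0; have := mulr_ge0 t1' x'0.
have := mulr_ge0 t0 y0; have := mulr_ge0 t1' y'0.
by move=> *; split; apply/andP; split; lra.
Qed.

Lemma regionE : region b f = subgraph.
Proof.
have [A1 AB] := bounds; apply/seteqP; split.
  apply: conv_hull_min; first exact: convex_subgraph.
  move=> [x y] [[/= xb ->]|[-> ->]].
    by split; rewrite /= ?lexx ?f_ge0.
  by split=> /=; rewrite lexx /= -?/B ?f0 -?/A; lra.
move=> -[x y] [/= xb yf]; set K := region b f.
have cK : convex_set K by apply: convex_conv_hull.
have Kgraph z : 0 <= z <= B -> K (z, f z).
  by move=> zb; apply: sub_conv_hull; left.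
have K00 : K (0, 0) by apply: sub_conv_hull; right.
have KB0 : K (B, 0) by rewrite -fb; apply: Kgraph; rewrite lexx andbT; lra.
apply: (convex_slab (h := f) (m := 0) cK _ K00 K00 KB0 Kgraph) => //=.
by move: xb yf => /andP[? _] /andP[? _]; lra.
Qed.

(** The graph lies above the chord from (0, a) to (b, 0), whose slope is at least
    -1. *)
Lemma chord_le x : 0 <= x <= B -> A - x <= f x.
Proof.
move=> /andP[x0 xB]; have [A1 AB] := bounds.
have B0 : B != 0 by rewrite gt_eqF //; lra.
have xB1 : x / B <= 1 by rewrite ler_pdivrMr ?mul1r //; lra.
have xB0 : 0 <= x / B by rewrite divr_ge0 //; lra.
have := @f_concave 0 B (1 - x / B); rewrite f0 fb -/A lexx /=.
have -> : (1 - x / B) * 0 + (1 - (1 - x / B)) * B = x by field.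
have -> : B = b%:~R by []; rewrite lexx -/B.
have -> : 0 <= B by lra.
have -> : 0 <= 1 - x / B <= 1 by apply/andP; split; lra.
move=> /(_ isT isT isT); apply: le_trans.
have : x / B * A <= x by rewrite mulrAC ler_pdivrMr ?ler_wpM2l //; lra.
lra.
Qed.

Lemma corner_sub x y : 0 <= x -> 0 <= y -> x + y <= A -> subgraph (x, y).
Proof.
move=> x0 y0 xyA; have [A1 AB] := bounds; have xB : 0 <= x <= B by lra.
have xyf := chord_le xB.
by split; [exact: xB|apply/andP; split => /=; lra].
Qed.

Lemma breakpoint_cover (x0 : int) (s : seq int) (x : R) :
  x0%:~R <= x <= (last x0 s)%:~R ->
  x = x0%:~R \/ exists2 I, I \in zip (x0 :: s) s & x \in `[I.1%:~R, I.2%:~R].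
Proof.
elim: s x0 => [|x1 s IH] x0 /=; first by move=> /le_anti ->; left.
move=> /andP[x0x xl]; right; have [xx1|x1x] := leP x x1%:~R.
  by exists (x0, x1); rewrite ?mem_head //= in_itv /= x0x.
have [|xE|[I Is xI]] := IH x1; first by rewrite xl ltW.
  by rewrite xE ltxx in x1x.
by exists I => //; rewrite inE Is orbT.
Qed.

(** On each segment of the graph the condition is a linear inequality, so the set
    is a finite union of polygons. *)
Lemma closed_subgraph : closed subgraph.
Proof.
have [s [ps ls _ sI]] := f_pl.
have -> : subgraph = [set p : plane R | (-1) * p.1 + 0 * p.2 <= 0] `&`
    [set p : plane R | 0 * p.1 + (-1) * p.2 <= 0] `&`
    [set p : plane R | (0%:~R <= p.1 <= (last 0 s)%:~R) /\ p.2 <= f p.1].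
  apply/seteqP; split=> -[x y]; rewrite /subgraph /= ls; last first.
    by move=> [[x0 y0] [/andP[_ xb] yf]]; split; apply/andP; split; lra.
  by move=> [/andP[x0 xb] /andP[y0 yf]]; split; split; rewrite ?x0 //; lra.
apply: closedI; first by apply: closedI; apply: closed_halfplane.
elim: s (0 : int) ps sI {ls} => [|x1 s IH] x0 /=.
  move=> _ _.
  have -> : [set p : plane R | x0%:~R <= p.1 <= x0%:~R /\ p.2 <= f p.1] =
      [set p : plane R | 1 * p.1 + 0 * p.2 <= x0%:~R] `&`
      [set p : plane R | (-1) * p.1 + 0 * p.2 <= - x0%:~R] `&`
      [set p : plane R | 0 * p.1 + 1 * p.2 <= f x0%:~R].
    apply/seteqP; split=> -[x y] /=.
      by move=> [/le_anti <- yf]; split; [split|]; lra.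
    move=> [[xx0 x0x] yf]; have -> : x = x0%:~R by lra.
    by rewrite lexx; split=> //; lra.
  by apply: closedI; [apply: closedI|]; apply: closed_halfplane.
move=> /andP[x01 ps] sI.
have [k [c fkc]] := sI (x0, x1) (mem_head _ _); rewrite /= in fkc.
have x1l : (x1%:~R : R) <= (last x1 s)%:~R.
  by rewrite ler_int path_le_last ?mem_head.
have -> : [set p : plane R | x0%:~R <= p.1 <= (last x1 s)%:~R /\ p.2 <= f p.1] =
    ([set p : plane R | 1 * p.1 + 0 * p.2 <= x1%:~R] `&`
     [set p : plane R | (-1) * p.1 + 0 * p.2 <= - x0%:~R] `&`
     [set p : plane R | (- k) * p.1 + 1 * p.2 <= c]) `|`
    [set p : plane R | x1%:~R <= p.1 <= (last x1 s)%:~R /\ p.2 <= f p.1].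
  have x01' : (x0%:~R : R) < x1%:~R by rewrite ltr_int.
  apply/seteqP; split=> -[x y] /=.
    move=> [/andP[x0x xl] yf]; have [x1x|xx1] := leP x1%:~R x.
      by right; rewrite xl.
    left; rewrite fkc ?in_itv /= ?x0x ?(ltW xx1) // in yf.
    by split; [split|]; lra.
  case=> [[[xx1 x0x] yk]|[/andP[x1x xl] yf]]; last first.
    by split=> //; rewrite xl andbT; lra.
  by split; [apply/andP; split|rewrite fkc ?in_itv /=]; try apply/andP; try split; lra.
apply: closedU; last by apply: IH => // I Is; apply: sI; rewrite inE Is orbT.
by apply: closedI; [apply: closedI|]; apply: closed_halfplane.
Qed.

(** Beyond 1 this is concavity with [f 0 = a >= f 1].  On [0, 1] the graph is a
    segment, because breakpoints are integers. *)
Lemma f_le_a x : 0 <= x <= B -> f x <= A.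
Proof.
move=> /andP[x0 xB]; have [A1 AB] := bounds.
have [x1|x1] := leP 1 x.
  have xn0 : x != 0 by rewrite gt_eqF //; lra.
  have xi0 : 0 <= x^-1 by rewrite invr_ge0.
  have xi1 : x^-1 <= 1 by rewrite invf_le1 //; lra.
  have := @f_concave x 0 x^-1; rewrite f0 mulVf // mulr0 addr0 -/A -/B.
  rewrite x0 xB xi0 xi1 lexx /= => /(_ isT); have -> : 0 <= B by lra.
  move=> /(_ isT isT) fx; have : x^-1 * f x <= x^-1 * A by move: f1; rewrite -/A; lra.
  by rewrite ler_pM2l // invr_gt0; lra.
have [[|x1' s] [ps ls _ sI]] := f_pl.
  by exfalso; move: AB A1; rewrite /B -ls /=; lra.
have [k [c fkc]] := sI (0, x1') (mem_head _ _).
move: ps => /= /andP[x1'0 _]; have X1 : (1 : R) <= x1'%:~R by rewrite (ler1z R); lia.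
have fE y : 0 <= y <= 1 -> f y = k * y + c.
  by move=> /andP[y0 y1]; apply: fkc; rewrite in_itv /= y0 /=; lra.
have cA : c = A by have := fE 0; rewrite f0 mulr0 add0r lexx ler01 => /(_ isT) <-.
have k0 : k <= 0.
  by move: f1; rewrite (fE 1) ?ler01 ?lexx // -/A -cA; lra.
have := mulr_le0_ge0 k0 x0; rewrite (fE x) ?x0 ?(ltW x1) // cA; lra.
Qed.

(** By concavity the triangle with corners (0, 0), (b, 0), (x, f x) lies below the
    graph, and it contains a neighbourhood of the point. *)
Lemma subgraph_interior x y : 0 < x < B -> 0 < y < f x ->
  interior subgraph (x, y).
Proof.
move=> /andP[x0 xB] /andP[y0 yf].
have xB' : 0 <= x <= B by rewrite !ltW.
(* The open triangle with corners (0, 0), (B, 0) and (x, f x). *)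
pose U := [set p : plane R | (-1) * p.1 + 0 * p.2 < 0] `&`
  [set p : plane R | 1 * p.1 + 0 * p.2 < B] `&`
  [set p : plane R | 0 * p.1 + (-1) * p.2 < 0] `&`
  ([set p : plane R | (- f x) * p.1 + x * p.2 < 0] `&`
   [set p : plane R | f x * p.1 + (B - x) * p.2 < f x * B]).
have oU : open U by do !apply: openI; apply: open_halfplane.
have Uxy : U (x, y).
  have := ltr_pM2l x0 y (f x); have := @ltr_pM2l R (B - x) _ y (f x).
  by rewrite subr_gt0 => /(_ xB); rewrite yf => h1 h2; rewrite /U /=; do !split; lra.
have : nbhs (x, y) U by apply: open_nbhs_nbhs.
apply: filterS => -[x' y'] [[[/= x'0 x'B] y'0] [/= Hl Hr]].
split=> /=; first by apply/andP; split; rewrite -/B; lra.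
apply/andP; split; first by lra.
have [x'x|xx'] := leP x' x.
  have t01 : 0 <= x' / x <= 1.
    by rewrite divr_ge0 ?ler_pdivrMr //; lra.
  have := f_concave xB' (_ : 0 <= 0 <= B) t01.
  rewrite lexx f0 mulr0 addr0 divfK ?gt_eqF // => /(_ ltac:(lra)).
  apply: le_trans; have : y' <= x' / x * f x.
    by rewrite mulrAC ler_pdivlMr //; lra.
  have := mulr_ge0 (_ : 0 <= 1 - x' / x) (_ : 0 <= A); have [A1 _] := bounds.
  rewrite -/A; move: t01 => /andP[t0 t1].
  by move=> /(_ ltac:(lra) ltac:(lra)); lra.
have Bx : 0 < B - x by lra.
have t01 : 0 <= (B - x') / (B - x) <= 1.
  by rewrite divr_ge0 ?ler_pdivrMr //; lra.
have := f_concave xB' (_ : 0 <= B <= B) t01.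
rewrite lexx fb mulr0 addr0.
have -> : (B - x') / (B - x) * x + (1 - (B - x') / (B - x)) * B = x'.
  by field; rewrite gt_eqF.
move=> /(_ ltac:(lra)); apply: le_trans.
by rewrite mulrAC ler_pdivlMr //; lra.
Qed.

(** The vertices are the two ends of the last cut and the breakpoints of the
    graph. *)
Lemma polygon_last_slice (m : nat) : m%:R <= A ->
  lattice_polygon (slice m.+1 subgraph m).
Proof.
move=> mA; have [A1 AB] := bounds; have [s [ps ls sint sI]] := f_pl.
have m0 : 0 <= (m%:R : R) by rewrite ler0n.
have path_bound c : c \in 0 :: s -> 0 <= c <= b.
  move=> cs; rewrite -ls path_le_last // andbT; move: cs; rewrite inE.
  case/orP => [/eqP-> //|]; move: ps; rewrite lt_path_sortedE => /andP[/allP H _].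
  by move=> /H /ltW.
have pathB c : c \in 0 :: s -> 0 <= (c%:~R : R) <= B.
  by move=> /path_bound; rewrite ler0z ler_int.
pose S := [:: (m%:R, 0) : plane R; (0, m%:R)] ++
  [seq (c%:~R, f c%:~R) : plane R | c <- 0 :: s].
have memS p : p \in S -> [\/ p = (m%:R, 0), p = (0, m%:R) |
    exists2 c, c \in 0 :: s & p = (c%:~R, f c%:~R)].
  rewrite mem_cat => /orP[|/mapP[c cs ->]]; last by constructor 3; exists c.
  by rewrite !inE => /orP[]/eqP ->; [constructor 1|constructor 2].
exists [set` S]; split; first exact: finite_seq.
  move=> p /memS[->|->|].
  - by split; rewrite /= ?natr_int ?int_num0.
  - by split; rewrite /= ?natr_int ?int_num0.
  by move=> [c cs ->]; split => /=; [rewrite intr_int|exact: sint].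
apply/seteqP; split; last first.
  apply: conv_hull_min; first exact: convex_slice convex_subgraph _.
  move=> p /memS[->|->|[c cs ->]].
  - split; first by apply: corner_sub; rewrite ?addr0.
    by split; [rewrite /= addr0|right].
  - split; first by apply: corner_sub; rewrite ?add0r.
    by split; [rewrite /= add0r|right].
  have cB := pathB _ cs; split; first by split=> //=; rewrite lexx f_ge0.
  by split; [have /= := chord_le cB; lra|right].
set K := conv_hull _; have cK : convex_set K by apply: convex_conv_hull.
have KS p : p \in S -> K p by move=> pS; apply: sub_conv_hull.
have Kbreak c : c \in 0 :: s -> K (c%:~R, f c%:~R).
  by move=> cs; apply: KS; rewrite /S mem_cat map_f ?orbT.
have K1 : K (m%:R, 0) by apply: KS; rewrite /S !inE eqxx.
have K2 : K (0, m%:R) by apply: KS; rewrite /S !inE eqxx orbT.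
have zip_mem (I : int * int) (x0 : int) (s' : seq int) : I \in zip (x0 :: s') s' ->
    I.1 \in x0 :: s' /\ I.2 \in x0 :: s'.
  elim: s' x0 => //= x1 s' IH x0; rewrite !inE => /orP[/eqP->|/IH[]].
    by rewrite /= !eqxx !orbT.
  by rewrite !inE => /orP[->|->] /orP[->|->]; rewrite !orbT.
have Kgraph x : 0 <= x <= B -> K (x, f x).
  rewrite /B -ls => x01; have [->|[I Is xI]] := @breakpoint_cover 0 s x x01.
    by apply: Kbreak; rewrite mem_head.
  have [I1 I2] := zip_mem _ _ _ Is; have [k [c fkc]] := sI _ Is.
  move: (xI); rewrite in_itv /= => /andP[xI1 xI2].
  have := @convex_param R K 0 1 c k I.1%:~R I.2%:~R x cK.
  have := Kbreak _ I1; have := Kbreak _ I2.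
  rewrite !(fkc _) ?in_itv /= ?lexx ?xI1 ?xI2 ?(le_trans xI1 xI2) //.
  by rewrite !mul1r !add0r ![c + _]addrC => h2 h1; apply.
have K3 : K (B, 0) by rewrite -fb; apply: Kgraph; rewrite lexx andbT; lra.
move=> p [[pB pf] [mp _]].
exact: (convex_slab (h := f) cK m0 K1 K2 K3 Kgraph).
Qed.

Lemma subgraph_quadrant p : subgraph p -> 0 <= p.1 /\ 0 <= p.2.
Proof. by move=> [/andP[? _] /andP[? _]]. Qed.

(** The graph meets the line x + y = a at x = 0 and is not below it at x = a; if it
    is above it at one more point, then by concavity it is above it in between. *)
Lemma strict_chord x0 x : 0 <= x0 <= B -> A - x0 < f x0 -> 0 < x < A -> A - x < f x.
Proof.
move=> /andP[x00 x0B] fx0 /andP[x_0 xA]; have [A1 AB] := bounds.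
have x0p : 0 < x0.
  rewrite lt_def x00 andbT; apply/eqP => e; move: fx0; rewrite e f0 subr0.
  by rewrite ltxx.
have [xx0|x0x] := leP x x0.
  have t01 : 0 <= x / x0 <= 1 by rewrite divr_ge0 ?ler_pdivrMr //; lra.
  have := @f_concave x0 0 (x / x0); rewrite x00 x0B t01 f0 mulr0 addr0 lexx /=.
  rewrite divfK ?gt_eqF // => /(_ isT); have -> : 0 <= b%:~R :> R by rewrite -/B; lra.
  move=> /(_ isT isT); apply: lt_le_trans.
  have t0 : 0 < x / x0 by rewrite divr_gt0.
  have := fx0; rewrite -(ltr_pM2l t0) mulrBr divfK ?gt_eqF // -/A; lra.
have t01 : 0 < (A - x) / (A - x0) <= 1.
  by rewrite divr_gt0 ?ler_pdivrMr //; lra.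
have t0 : 0 < (A - x) / (A - x0) by case/andP: t01.
have := @f_concave x0 A ((A - x) / (A - x0)).
rewrite x00 x0B -/B AB; have -> : 0 <= A by lra.
rewrite (ltW t0) (andP t01).2 => /(_ isT isT isT).
have -> : (A - x) / (A - x0) * x0 + (1 - (A - x) / (A - x0)) * A = x.
  by field; rewrite gt_eqF //; lra.
apply: lt_le_trans; have fA : 0 <= f A by apply: f_ge0; rewrite AB andbT; lra.
have := mulr_ge0 (_ : 0 <= 1 - (A - x) / (A - x0)) fA.
have := fx0; rewrite -(ltr_pM2l t0) divfK ?gt_eqF //; last by lra.
by move: t01 => /andP[_ t1] h1 /(_ ltac:(lra)); lra.
Qed.

(** The number N of cuts is [a] if Delta reaches beyond the line x + y = a and
    [a - 1] otherwise.  The remaining claims about N hold for different reasons in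
    the two cases: in the first one they follow from [strict_chord] and y <= a, in
    the second one from the equation x + y = a of the hypotenuse. *)
Lemma number_of_slices : exists N : nat,
  [/\ N%:R <= A, exists2 p, subgraph p & N%:R < p.1 + p.2,
      forall p, interior subgraph p -> lattice p -> p.2 < N%:R
    & (1 < N)%N -> [/\ N%:R - 1 < B, N%:R - 1 < f 1 & 1 < f (N%:R - 1)]].
Proof.
have [A1 AB] := bounds.
have [n an] : exists n : nat, a = n.+1.
  by exists `|a|.-1%N; move: hab; lia.
have An : A = n%:R + 1 by rewrite /A an -pmulrn natr1.
have [[x0 xB fx]|] := pselect (exists2 x0, 0 <= x0 <= B & A - x0 < f x0).
  exists n.+1; have An' : A = n.+1%:R by rewrite /A an.
  rewrite -An'; split=> //.
  - exists (x0, f x0); last by rewrite /=; lra.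
    by split=> //=; rewrite lexx f_ge0.
  - move=> p /interior_square[e e0 He] _.
    have [||/= pB /andP[_ pf]] := He (p.1, p.2 + e);
    rewrite /= ?subrr ?normr0 ?(ltW e0) //.
      by rewrite addrAC subrr add0r gtr0_norm.
    by have := f_le_a pB; lra.
  rewrite ltnS => n0; have n1 : 1 <= n%:R :> R by rewrite ler1n.
  split; first by lra.
    by apply: (strict_chord xB fx); apply/andP; split; lra.
  have := strict_chord (x := A - 1) xB fx.
  have -> : A - (A - 1) = 1 by lra.
  by apply; apply/andP; split; lra.
move=> /forall2NP nex.
have fE x : 0 <= x <= B -> f x = A - x.
  move=> xB; apply/eqP; rewrite eq_le chord_le // andbT leNgt.
  by apply/negP => fx; have [] := nex x.
have BA : B = A.
  have B0 : 0 <= B by lra.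
  by have := fE B; rewrite B0 lexx {3}/B fb => /(_ isT); lra.
exists n; rewrite An in BA fE *; split; first by lra.
- exists (n%:R + 1, 0); last by rewrite /=; lra.
  by apply: corner_sub; rewrite ?An ?addr0 ?lexx //; rewrite addr_ge0.
- move=> p /interior_square[e e0 He] [p1 _].
  have [||[/= /andP[p10 _] _]] := He (p.1 - e, p.2);
    rewrite /= ?subrr ?normr0 ?(ltW e0) //.
    by rewrite addrAC subrr add0r normrN gtr0_norm.
  have p11 : 1 <= p.1.
    have /natrP[j pj] : p.1 \is a Num.nat by rewrite natrEint p1 /=; lra.
    by move: p10; rewrite /= pj ler1n; case: (j) => //; lra.
  have [||[/= pB /andP[_ pf]]] := He (p.1, p.2 + e);
    rewrite /= ?subrr ?normr0 ?(ltW e0) //.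
    by rewrite addrAC subrr add0r gtr0_norm.
  by move: pf; rewrite /= fE //; lra.
move=> n1; have n2 : 2 <= n%:R :> R by rewrite ler_nat.
split; rewrite ?fE; try (apply/andP; split); lra.
Qed.

Lemma interior_subgraph_gt0 p : interior subgraph p -> 0 < p.1 /\ 0 < p.2.
Proof.
move=> /interior_square[e e0 He].
have [||[/= /andP[? _] _]] := He (p.1 - e, p.2);
    rewrite /= ?subrr ?normr0 ?(ltW e0) //.
  by rewrite addrAC subrr add0r normrN gtr0_norm.
have [||[_ /= /andP[? _]]] := He (p.1, p.2 - e);
    rewrite /= ?subrr ?normr0 ?(ltW e0) //.
  by rewrite addrAC subrr add0r normrN gtr0_norm.
by split; lra.
Qed.

Lemma width_subgraph N :
  (forall p, interior subgraph p -> lattice p -> p.2 < N%:R) ->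
  ((1 < N)%N -> [/\ N%:R - 1 < B, N%:R - 1 < f 1 & 1 < f (N%:R - 1)]) ->
  is_lattice_width (interior_hull subgraph) ((maxn 1 N)%:Z - 2).
Proof.
move=> top tri.
have strip p : interior subgraph p -> lattice p -> 1 <= p.2 <= N%:R - 1.
  move=> ip lp; have := top _ ip lp; have [_ p0] := interior_subgraph_gt0 ip.
  have [_] := lp => p2; have /natrP[j pj] : p.2 \is a Num.nat.
    by rewrite natrEint p2 ltW.
  move: p0; rewrite pj ltr0n ltr_nat => j0 jN.
  by rewrite ler1n j0 lerBrDr natr1 ler_nat.
have [N1|N1] := leqP N 1.
  rewrite (_ : _ - 2 = -1); last by lia.
  apply: width_no_interior_point => p ip /(strip _ ip)/andP[p1 p2].
  have : (N%:R : R) <= 1 by rewrite lern1.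
  lra.
case: N N1 top tri strip => [|[|w]] // N1 _ tri strip.
have [wB wf wf'] := tri N1.
rewrite (_ : _ - 2 = w%:Z); last by lia.
have wE : (w.+2%:R : R) - 1 = 1 + w%:R by rewrite -!natr1; ring.
rewrite wE in wB wf wf' strip; have w0 : 0 <= w%:R :> R by rewrite ler0n.
by apply: width_interior_triangle => //; apply: subgraph_interior;
  apply/andP; split; lra.
Qed.

Lemma region_subdivision : let Delta := region b f in
  exists (r : nat) (D : 'I_r -> set (plane R)) (v : plane R -> R^o),
    [/\ regular_subdivision Delta D,
        realizes Delta v D,
        forall p, Delta p -> lattice p -> v p \is a Num.int,
        exists2 w : int, is_lattice_width (interior_hull Delta) w
                       & is_gonality R (weighted_graph D v) (w + 2) &
        ~ Zequivalent Delta (@twoUpsilon R)].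
Proof.
rewrite /= regionE; have [A1 AB] := bounds.
have [N [NA tip top tri]] := number_of_slices.
have quad := subgraph_quadrant; have corner := corner_sub.
have last := polygon_last_slice NA.
exists N.+1, (slices subgraph), (@diagonal_bend R N.+1); split.
- exact: (regular_slices (ltn0Sn N) convex_subgraph closed_subgraph quad A1).
- exact: (realizes_slices (ltn0Sn N) convex_subgraph closed_subgraph quad A1).
- by move=> p; apply: (diagonal_bend_int (ltn0Sn N) quad).
- exists ((maxn 1 N)%:Z - 2); first exact: width_subgraph.
  rewrite subrK; apply: (@staircase_gonality _ _ N); apply: staircase_chain.
    by move=> l m; apply: (int_length_slices (ltn0Sn N) quad A1).
  by move=> i; apply: (normal_slice (ltn0Sn N) A1).
apply: (@quadrant_not_twoUpsilon _ _ A B) => //.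
- lra.
- lra.
- by apply: corner; lra.
- by split; rewrite /= ?fb lexx ?andbT //=; rewrite -/B; lra.
by apply: corner; lra.
Qed.

End Region.

Theorem theorem11 (R : realType) (a b : int) (f : R^o -> R^o)
    (hab : 1 <= a <= b)
    (f_concave : convex_function [set x : R^o | 0 <= x <= b%:~R] (fun x => - f x))
    (f_cont : {within [set x : R^o | 0 <= x <= b%:~R], continuous f})
    (f_pl : lattice_piecewise_linear b f)
    (f_ge0 : forall x : R, 0 <= x <= b%:~R -> 0 <= f x)
    (f0 : f 0 = a%:~R) (f1 : f 1 <= a%:~R) (fb : f b%:~R = 0) :
  let Delta := region b f in
  exists (r : nat) (D : 'I_r -> set (plane R)) (v : plane R -> R^o),
    [/\ regular_subdivision Delta D,
        realizes Delta v D,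
        forall p, Delta p -> lattice p -> v p \is a Num.int,
        ~ Zequivalent Delta (@twoUpsilon R) ->
          exists2 w : int, is_lattice_width (interior_hull Delta) w
                         & is_gonality R (weighted_graph D v) (w + 2) &
        Zequivalent Delta (@twoUpsilon R) ->
          is_gonality R (weighted_graph D v) 3].
Proof.
move=> Delta.
have concave x y t : 0 <= x <= b%:~R -> 0 <= y <= b%:~R -> 0 <= t <= 1 ->
    t * f x + (1 - t) * f y <= f (t * x + (1 - t) * y).
  move=> xb yb /andP[t0 t1].
  have : - f (t * x + (1 - t) * y) <= t * - f x + (1 - t) * - f y.
    exact: f_concave (Itv01 t0 t1) x y (mem_set xb) (mem_set yb).
  lra.
have [r [D [v [H1 H2 H3 H4 H5]]]] :=
  region_subdivision hab concave f_pl f_ge0 f0 f1 fb.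
by exists r, D, v; split.
Qed.
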